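(* (1) The maps $\sigma:\mathbf{NExt}(\mathtt{KM_R})\to\mathbf{NExt}(\mathtt{GL_R})$, $\sigma\mathtt{L}=\mathtt{GL_R}\oplus\{T(\Gamma/\Delta):\Gamma/\Delta\in\mathtt{L}\}$, and $\rho:\mathbf{NExt}(\mathtt{GL_R})\to\mathbf{NExt}(\mathtt{KM_R})$, $\rho\mathtt{M}=\{\Gamma/\Delta:T(\Gamma/\Delta)\in\mathtt{M}\}$, are mutually inverse complete lattice isomorphisms. (2) The maps $\sigma:\mathbf{NExt}(\mathtt{KM})\to\mathbf{NExt}(\mathtt{GL})$, $\sigma\mathtt{L}=\mathtt{GL}\oplus\{T\varphi:\varphi\in\mathtt{L}\}$, and $\rho:\mathbf{NExt}(\mathtt{GL})\to\mathbf{NExt}(\mathtt{KM})$, $\rho\mathtt{M}=\{\varphi:T\varphi\in\mathtt{M}\}$, are mutually inverse complete lattice isomorphisms.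
   Context: Msi formulae use $\land,\lor,\to,\boxtimes,\bot,\top$. $\mathtt{IPCK}$: least substitution-closed set containing $\mathtt{IPC}$ and $\boxtimes(p\to q)\to(\boxtimes p\to\boxtimes q)$, closed under modus ponens and $\varphi\mapsto\boxtimes\varphi$; msi-logics are such sets extending $\mathtt{IPCK}$. $\mathtt{KM}=\mathtt{IPCK}\oplus p\to\boxtimes p\oplus(\boxtimes p\to p)\to p\oplus\boxtimes p\to(q\lor(q\to p))$. A rule is a pair $\Gamma/\Delta$ of finite sets of formulae; rule systems are sets of rules closed under substitution, reflexivity, weakening on both sides and cut. Msi-rule systems contain $/\varphi$ for $\varphi\in\mathtt{IPCK}$, $\varphi,\varphi\to\psi/\psi$, $\varphi/\boxtimes\varphi$. Normal modal logics/rule systems over $\land,\lor,\neg,\square,\bot,\top$ as usual (extending $\mathtt{K}$, closed under modus ponens and necessitation). $\mathtt{GL}=\mathtt{K}\oplus\square(\square p\to p)\to\square p$. $\mathtt{X_R}$ is the least rule system of the relevant kind containing $/\varphi$ for $\varphi\in\mathtt{X}$; $\mathbf{NExt}(\mathtt{X})$ is the set of logics (resp. rule systems) of the relevant kind extending $\mathtt{X}$, a complete lattice with intersection as meet and $\oplus$ (least logic/rule system containing the sets) as join. Write $\square^+\varphi:=\square\varphi\land\varphi$. Translation $T$: $T(\bot)=\bot$, $T(\top)=\top$, $T(p)=\square^+p$, commutes with $\land,\lor$, $T(\varphi\to\psi)=\square^+(\neg T\varphi\lor T\psi)$, $T(\boxtimes\varphi)=\square T\varphi$, $T(\Gamma/\Delta)=T[\Gamma]/T[\Delta]$.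 *)

(* Defs.v *)
From HB Require Import structures.
From mathcomp Require Import all_boot finmap.
From mathcomp Require Import boolp classical_sets functions.

Set Implicit Arguments.
Unset Strict Implicit.
Unset Printing Implicit Defensive.

Local Open Scope classical_set_scope.

Inductive msi : Type :=
| IVar of nat
| IBot
| ITop
| IAnd of msi & msi
| IOr of msi & msi
| IImp of msi & msi
| IBox of msi.

Inductive modal : Type :=
| MVar of nat
| MBot
| MTop
| MAnd of modal & modal
| MOr of modal & modal
| MNeg of modal
| MBox of modal.

Definition MImp (a b : modal) : modal := MOr (MNeg a) b.

Fixpoint msi_subst (s : nat -> msi) (a : msi) : msi :=
  match a with
  | IVar n => s n
  | IBot => IBot
  | ITop => ITop
  | IAnd b c => IAnd (msi_subst s b) (msi_subst s c)
  | IOr b c => IOr (msi_subst s b) (msi_subst s c)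
  | IImp b c => IImp (msi_subst s b) (msi_subst s c)
  | IBox b => IBox (msi_subst s b)
  end.

Fixpoint modal_subst (s : nat -> modal) (a : modal) : modal :=
  match a with
  | MVar n => s n
  | MBot => MBot
  | MTop => MTop
  | MAnd b c => MAnd (modal_subst s b) (modal_subst s c)
  | MOr b c => MOr (modal_subst s b) (modal_subst s c)
  | MNeg b => MNeg (modal_subst s b)
  | MBox b => MBox (modal_subst s b)
  end.

(* Encodings into [GenTree.tree nat]: they only serve to equip formulae with a
   countable type structure, so that finite sets [{fset _}] can be formed. *)
Fixpoint msi_encode (a : msi) : GenTree.tree nat :=
  match a with
  | IVar n => GenTree.Leaf n
  | IBot => GenTree.Node 0 [::]
  | ITop => GenTree.Node 1 [::]
  | IAnd b c => GenTree.Node 2 [:: msi_encode b; msi_encode c]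
  | IOr b c => GenTree.Node 3 [:: msi_encode b; msi_encode c]
  | IImp b c => GenTree.Node 4 [:: msi_encode b; msi_encode c]
  | IBox b => GenTree.Node 5 [:: msi_encode b]
  end.

Fixpoint msi_decode (t : GenTree.tree nat) : msi :=
  match t with
  | GenTree.Leaf n => IVar n
  | GenTree.Node 1 [::] => ITop
  | GenTree.Node 2 [:: b; c] => IAnd (msi_decode b) (msi_decode c)
  | GenTree.Node 3 [:: b; c] => IOr (msi_decode b) (msi_decode c)
  | GenTree.Node 4 [:: b; c] => IImp (msi_decode b) (msi_decode c)
  | GenTree.Node 5 [:: b] => IBox (msi_decode b)
  | _ => IBot
  end.

Lemma msi_encodeK : cancel msi_encode msi_decode.
Proof. by elim=> //= [b -> c ->|b -> c ->|b -> c ->|b ->]. Qed.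

HB.instance Definition _ := Countable.copy msi (can_type msi_encodeK).

Fixpoint modal_encode (a : modal) : GenTree.tree nat :=
  match a with
  | MVar n => GenTree.Leaf n
  | MBot => GenTree.Node 0 [::]
  | MTop => GenTree.Node 1 [::]
  | MAnd b c => GenTree.Node 2 [:: modal_encode b; modal_encode c]
  | MOr b c => GenTree.Node 3 [:: modal_encode b; modal_encode c]
  | MNeg b => GenTree.Node 4 [:: modal_encode b]
  | MBox b => GenTree.Node 5 [:: modal_encode b]
  end.

Fixpoint modal_decode (t : GenTree.tree nat) : modal :=
  match t with
  | GenTree.Leaf n => MVar n
  | GenTree.Node 1 [::] => MTop
  | GenTree.Node 2 [:: b; c] => MAnd (modal_decode b) (modal_decode c)
  | GenTree.Node 3 [:: b; c] => MOr (modal_decode b) (modal_decode c)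
  | GenTree.Node 4 [:: b] => MNeg (modal_decode b)
  | GenTree.Node 5 [:: b] => MBox (modal_decode b)
  | _ => MBot
  end.

Lemma modal_encodeK : cancel modal_encode modal_decode.
Proof. by elim=> //= [b -> c ->|b -> c ->|b ->|b ->]. Qed.

HB.instance Definition _ := Countable.copy modal (can_type modal_encodeK).

Definition rule (F : choiceType) : choiceType := ({fset F} * {fset F})%type.

Definition map_rule (F G : choiceType) (f : F -> G) (r : rule F) : rule G :=
  ([fset f x | x in r.1]%fset, [fset f x | x in r.2]%fset).

Definition axiom_rule (F : choiceType) (a : F) : rule F :=
  (fset0, [fset a]%fset).

Definition rule_system (F : choiceType) (subst : (nat -> F) -> F -> F)
    (S : set (rule F)) : Prop :=
  [/\ (forall (s : nat -> F) (r : rule F), S r -> S (map_rule (subst s) r)),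
      (forall a : F, S ([fset a], [fset a])%fset),
      (forall G D G' D' : {fset F}, S (G, D) -> S (G `|` G', D `|` D')%fset)
    & (forall (G D : {fset F}) (a : F),
         S (G, a |` D)%fset -> S (a |` G, D)%fset -> S (G, D))].

(* In [NExt C X], [C] is the class of objects considered (logics or rule systems of a given
   kind), each
   object being a set of formulae or of rules, and [X] is the least object
   allowed. *)

Section Extensions.
Variable U : Type.
Implicit Types (C : set (set U)) (X S : set U) (F : set (set U)).

Definition NExt C X : set (set U) := [set L | C L /\ X `<=` L].

Definition oplus C X S : set U := smallest C (X `|` S).

Definition nmeet F : set U := \bigcap_(L in F) L.

(* Including the base [X] only matters for the empty family, whose join in
   [NExt C X] is the least element. *)
Definition njoin C X F : set U := oplus C X (\bigcup_(L in F) L).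

End Extensions.

Definition complete_lattice_morphism (U V : Type)
    (C : set (set U)) (X : set U) (D : set (set V)) (Y : set V)
    (f : set U -> set V) : Prop :=
  [/\ set_fun (NExt C X) (NExt D Y) f,
      (forall F, F `<=` NExt C X -> f (nmeet F) = nmeet (f @` F))
    & (forall F, F `<=` NExt C X -> f (njoin C X F) = njoin D Y (f @` F))].

Definition mutually_inverse_complete_lattice_isos (U V : Type)
    (C : set (set U)) (X : set U) (D : set (set V)) (Y : set V)
    (f : set U -> set V) (g : set V -> set U) : Prop :=
  [/\ complete_lattice_morphism C X D Y f,
      complete_lattice_morphism D Y C X g,
      (forall L, NExt C X L -> g (f L) = L)
    & (forall M, NExt D Y M -> f (g M) = M)].

Definition msi_subst_closed (L : set msi) : Prop :=
  forall (s : nat -> msi) (a : msi), L a -> L (msi_subst s a).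
Definition msi_mp_closed (L : set msi) : Prop :=
  forall a b : msi, L a -> L (IImp a b) -> L b.
Definition msi_nec_closed (L : set msi) : Prop :=
  forall a : msi, L a -> L (IBox a).

Section MsiAxioms.
Let p := IVar 0.
Let q := IVar 1.
Let r := IVar 2.

Definition IPC_axioms : set msi := [set a | a \in
  [:: IImp p (IImp q p);
      IImp (IImp p (IImp q r)) (IImp (IImp p q) (IImp p r));
      IImp (IAnd p q) p;
      IImp (IAnd p q) q;
      IImp p (IImp q (IAnd p q));
      IImp p (IOr p q);
      IImp q (IOr p q);
      IImp (IImp p r) (IImp (IImp q r) (IImp (IOr p q) r));
      IImp IBot p;
      ITop]].

Definition msi_K_axiom : msi :=
  IImp (IBox (IImp p q)) (IImp (IBox p) (IBox q)).

Definition KM_axioms : set msi :=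
  [set IImp p (IBox p);
       IImp (IImp (IBox p) p) p;
       IImp (IBox p) (IOr q (IImp q p))].

End MsiAxioms.

(* Theorems of IPC, with substitution instances taken in the whole msi
   language. *)
Definition IPC : set msi :=
  smallest [set L | msi_subst_closed L /\ msi_mp_closed L] IPC_axioms.

Definition IPCK : set msi :=
  smallest [set L | [/\ msi_subst_closed L, msi_mp_closed L & msi_nec_closed L]]
           (IPC `|` [set msi_K_axiom]).

Definition msi_logic : set (set msi) :=
  [set L | [/\ IPCK `<=` L, msi_subst_closed L, msi_mp_closed L
             & msi_nec_closed L]].

Definition msi_rule_system : set (set (rule msi)) :=
  [set S | [/\ rule_system msi_subst S,
               (forall a, IPCK a -> S (axiom_rule a)),
               (forall a b, S ([fset a; IImp a b], [fset b])%fset)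
             & (forall a, S ([fset a], [fset IBox a])%fset)]].

Definition KM : set msi := oplus msi_logic IPCK KM_axioms.

Definition KM_R : set (rule msi) :=
  smallest msi_rule_system [set axiom_rule a | a in KM].

Definition modal_subst_closed (L : set modal) : Prop :=
  forall (s : nat -> modal) (a : modal), L a -> L (modal_subst s a).
Definition modal_mp_closed (L : set modal) : Prop :=
  forall a b : modal, L a -> L (MImp a b) -> L b.
Definition modal_nec_closed (L : set modal) : Prop :=
  forall a : modal, L a -> L (MBox a).

(* Two-valued evaluation; boxed formulae are treated as additional atoms, whose
   values are given by [w]. *)
Fixpoint bool_eval (v : nat -> bool) (w : modal -> bool) (a : modal) : bool :=
  match a with
  | MVar n => v n
  | MBot => false
  | MTop => true
  | MAnd b c => bool_eval v w b && bool_eval v w c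
  | MOr b c => bool_eval v w b || bool_eval v w c
  | MNeg b => ~~ bool_eval v w b
  | MBox b => w b
  end.

Definition CPC : set modal := [set a | forall v w, bool_eval v w a].

Section ModalAxioms.
Let p := MVar 0.
Let q := MVar 1.

Definition modal_K_axiom : modal :=
  MImp (MBox (MImp p q)) (MImp (MBox p) (MBox q)).

Definition GL_axiom : modal :=
  MImp (MBox (MImp (MBox p) p)) (MBox p).

End ModalAxioms.

Definition K : set modal :=
  smallest [set L | [/\ modal_subst_closed L, modal_mp_closed L
                      & modal_nec_closed L]]
           (CPC `|` [set modal_K_axiom]).

Definition modal_logic : set (set modal) :=
  [set L | [/\ K `<=` L, modal_subst_closed L, modal_mp_closed L
             & modal_nec_closed L]].

Definition modal_rule_system : set (set (rule modal)) :=
  [set S | [/\ rule_system modal_subst S,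
               (forall a, K a -> S (axiom_rule a)),
               (forall a b, S ([fset a; MImp a b], [fset b])%fset)
             & (forall a, S ([fset a], [fset MBox a])%fset)]].

Definition GL : set modal := oplus modal_logic K [set GL_axiom].

Definition GL_R : set (rule modal) :=
  smallest modal_rule_system [set axiom_rule a | a in GL].

Definition MBoxPlus (a : modal) : modal := MAnd (MBox a) a.

Fixpoint T (a : msi) : modal :=
  match a with
  | IVar n => MBoxPlus (MVar n)
  | IBot => MBot
  | ITop => MTop
  | IAnd b c => MAnd (T b) (T c)
  | IOr b c => MOr (T b) (T c)
  | IImp b c => MBoxPlus (MOr (MNeg (T b)) (T c))
  | IBox b => MBox (T b)
  end.

Definition T_rule : rule msi -> rule modal := map_rule T.

Definition sigma_rules (L : set (rule msi)) : set (rule modal) :=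
  oplus modal_rule_system GL_R [set T_rule r | r in L].

Definition rho_rules (M : set (rule modal)) : set (rule msi) :=
  [set r | M (T_rule r)].

Definition sigma_logics (L : set msi) : set modal :=
  oplus modal_logic GL [set T a | a in L].

Definition rho_logics (M : set modal) : set msi := [set a | M (T a)].

Definition intersection_closed (U : Type) (C : set (set U)) : Prop :=
  forall F, F `<=` C -> C (nmeet F).

Lemma msi_logic_cap : intersection_closed msi_logic.
Proof.
move=> F FC; split=> [a Ka L /FC[]|s a aF L FL|a b aF abF L FL|a aF L FL].
- by move=> /(_ _ Ka).
- by case: (FC _ FL) => _ + _ _; apply; exact: aF.
- by case: (FC _ FL) => _ _ + _; apply; [exact: aF|exact: abF].
- by case: (FC _ FL) => _ _ _; apply; exact: aF.
Qed.

Lemma modal_logic_cap : intersection_closed modal_logic.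
Proof.
move=> F FC; split=> [a Ka L /FC[]|s a aF L FL|a b aF abF L FL|a aF L FL].
- by move=> /(_ _ Ka).
- by case: (FC _ FL) => _ + _ _; apply; exact: aF.
- by case: (FC _ FL) => _ _ + _; apply; [exact: aF|exact: abF].
- by case: (FC _ FL) => _ _ _; apply; exact: aF.
Qed.

Lemma rule_system_cap (F : choiceType) (subst : (nat -> F) -> F -> F) :
  intersection_closed (rule_system subst : set (set (rule F))).
Proof.
move=> E EC; split=> [s r rE S ES|a S ES|G D G' D' GD S ES|G D a h1 h2 S ES].
- by case: (EC _ ES) => + _ _ _; apply; exact: rE.
- by case: (EC _ ES).
- by case: (EC _ ES) => _ _ + _; apply; exact: GD.
- by case: (EC _ ES) => _ _ _ /(_ G D a); apply; [exact: h1|exact: h2].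
Qed.

Lemma msi_rule_system_cap : intersection_closed msi_rule_system.
Proof.
move=> F FC; split.
- by apply: rule_system_cap => S /FC[].
- by move=> a Ka S /FC[_ + _ _]; exact.
- by move=> a b S /FC[].
- by move=> a S /FC[].
Qed.

Lemma modal_rule_system_cap : intersection_closed modal_rule_system.
Proof.
move=> F FC; split.
- by apply: rule_system_cap => S /FC[].
- by move=> a Ka S /FC[_ + _ _]; exact.
- by move=> a b S /FC[].
- by move=> a S /FC[].
Qed.

Section CompleteLattice.
Variables (U : Type) (C : set (set U)) (X : set U).
Hypothesis Ccap : intersection_closed C.
Implicit Types (F : set (set U)) (L S : set U).

Lemma oplus_NExt S : NExt C X (oplus C X S).
Proof.
split; first by apply: Ccap => L [].
by apply: subset_trans (@sub_gen_smallest _ C (X `|` S)) => a; left.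
Qed.

Lemma nmeet_glb F : F `<=` NExt C X ->
  [/\ NExt C X (nmeet F), (forall L, F L -> nmeet F `<=` L)
    & (forall M, (forall L, F L -> M `<=` L) -> M `<=` nmeet F)].
Proof.
move=> FN; split.
- split; first by apply: Ccap => L /FN[].
  by move=> a Xa L /FN[_]; exact.
- by move=> L FL a; exact.
- by move=> M ML a Ma L FL; exact: ML Ma.
Qed.

Lemma njoin_lub F : F `<=` NExt C X ->
  [/\ NExt C X (njoin C X F), (forall L, F L -> L `<=` njoin C X F)
    & (forall M, NExt C X M -> (forall L, F L -> L `<=` M) ->
         njoin C X F `<=` M)].
Proof.
move=> FN; split; first exact: oplus_NExt.
- move=> L FL a La; apply: sub_gen_smallest; right.
  by exists L.
- move=> M [CM XM] FM; apply: smallest_sub => //.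
  by move=> a [/XM//|[L FL La]]; exact: FM La.
Qed.

End CompleteLattice.

(* Main.v *)
Require Import Defs.
From mathcomp Require Import all_boot finmap.
From mathcomp Require Import boolp classical_sets functions.

(* Both maps are monotone, so it is enough to show that they are mutually
   inverse.

   rho (sigma L) = L: a finite list of pairs (a_i, b_i) of msi formulae denotes
   the element /\ (~ a_i \/ b_i) of the free Boolean extension of a KM-algebra,
   its interior is /\ (a_i -> b_i), and its box is the IBox of its interior.
   This interprets modal formulae; the modal rules whose interpretations all
   lie in L form a GL-system that contains T[L] and reflects T back to L.

   sigma (rho M) = M: every modal rule is interderivable over GL with the
   T-image of an msi rule. In the canonical model of GL, let the type of a point
   be the set of formulae of a finite subformula-closed set Phi that it contains.
   By Loeb's axiom each type seen from a point x is seen at a point y above x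
   which does not see that type again, and there the type is determined by the
   open elements []~c and []~c /\ ~c, c ranging over types. Hence replacing each
   point by a fixed point with the same open elements (its shadow) preserves the
   truth of boxes and the set of types realized above any point; this
   replacement is a substitution by Boolean combinations of open elements, and
   such combinations are expressed through T by the interpretation above. *)

Set Implicit Arguments.
Unset Strict Implicit.
Unset Printing Implicit Defensive.

Local Open Scope classical_set_scope.

(** * Prime theories *)

Section PrimeTheories.
Variables (F : Type) (imp or : F -> F -> F) (L : set F).

Definition theory (X : set F) : Prop :=
  L `<=` X /\ forall a b, X a -> X (imp a b) -> X b.

Definition prime_theory (X : set F) : Prop :=
  [/\ theory X, (exists a, ~ X a)
    & forall a b, X (or a b) -> X a \/ X b].

Hypothesis L_weak : forall a b, L (imp a (imp b a)).
Hypothesis L_distr : forall a b c,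
  L (imp (imp a (imp b c)) (imp (imp a b) (imp a c))).
Hypothesis L_or : forall a b c,
  L (imp (imp a c) (imp (imp b c) (imp (or a b) c))).

Lemma theory_refl X a : theory X -> X (imp a a).
Proof.
move=> [LX XM].
exact: XM (LX _ (L_weak a a)) (XM _ _ (LX _ (L_weak a (imp a a))) (LX _ (L_distr _ _ _))).
Qed.

(** By the deduction theorem this set is the theory generated by [X] and [a]. *)
Lemma theory_extend X a : theory X -> theory [set b | X (imp a b)].
Proof.
move=> [LX XM]; split=> [b Lb|b c /= ab abc].
  exact: XM (LX _ Lb) (LX _ (L_weak _ _)).
exact: XM ab (XM _ _ abc (LX _ (L_distr _ _ _))).
Qed.

(** A theory maximal among those that contain [X] and omit [a] is prime, because every formula
    outside it implies [a]. *)
Lemma prime_extension X a : theory X -> ~ X a ->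
  exists Y, [/\ prime_theory Y, X `<=` Y & ~ Y a].
Proof.
move=> thX nXa.
(* The empty set is admitted because [Zorn_bigcup] also ranges over the empty chain. *)
pose P (A : set F) := A = set0 \/ [/\ theory A, X `<=` A & ~ A a].
have [|Y [PY Ymax]] := @Zorn_bigcup F P.
  move=> C CP Ctot.
  have [[A CA An0]|allempty] := pselect (exists2 A, C A & A !=set0); last first.
    left; apply/seteqP; split=> // b [B CB Bb]; apply: allempty.
    by exists B => //; exists b.
  have good B : C B -> B !=set0 -> [/\ theory B, X `<=` B & ~ B a].
    by move=> CB Bn0; case: (CP _ CB) Bn0 => [->|//] [].
  have [[LA _] XA _] := good _ CA An0.
  right; split; last 2 first.
  - by move=> b /XA Ab; exists A.
  - move=> [B CB Ba]; have [_ _] := good _ CB (ex_intro _ _ Ba); exact.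
  split=> [b /LA Ab|b c [B CB Bb] [D CD Dbc]]; first by exists A.
  have [BD|DB] := Ctot _ _ CB CD.
    exists D => //; have [[_ DM] _ _] := good _ CD (ex_intro _ _ Dbc).
    exact: DM (BD _ Bb) Dbc.
  exists B => //; have [[_ BM] _ _] := good _ CB (ex_intro _ _ Bb).
  exact: BM Bb (DB _ Dbc).
have PX : P X by right; split.
have Xaa : X (imp a a) by exact: theory_refl.
case: PY => [Y0|[thY XY nYa]].
  by case: (Ymax X _ PX); rewrite Y0; split=> // /(_ _ Xaa).
(* Otherwise the theory generated by [Y] and [b] omits [a] and properly extends [Y]. *)
have grow b : ~ Y b -> Y (imp b a).
  move=> nYb; apply: contrapT => nYba; have [LY YM] := thY.
  apply: (Ymax [set c | Y (imp b c)]).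
    split=> [c Yc|/(_ b)]; first exact: YM Yc (LY _ (L_weak _ _)).
    by move=> h; apply: nYb; apply: h; exact: theory_refl.
  right; split=> //; first exact: theory_extend.
  by move=> c /XY Yc; exact: YM Yc (LY _ (L_weak _ _)).
exists Y; split=> //; split=> //; first by exists a.
move=> b c Ybc; have [LY YM] := thY.
have [|nYb] := pselect (Y b); first by left.
have [|nYc] := pselect (Y c); first by right.
by case: nYa; apply: YM Ybc (YM _ _ (grow _ nYc) (YM _ _ (grow _ nYb) (LY _ (L_or _ _ _)))).
Qed.

Lemma prime_extension_imp X a b : theory X -> ~ X (imp a b) ->
  exists Y, [/\ prime_theory Y, X `<=` Y, Y a & ~ Y b].
Proof.
move=> thX nXab.
have [Y [pY XY nYb]] := prime_extension (theory_extend a thX) nXab.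
exists Y; split=> //; last by apply: XY; exact: theory_refl.
by move=> c Xc; apply: XY; case: thX => LX XM; exact: XM Xc (LX _ (L_weak _ _)).
Qed.

End PrimeTheories.

(** * The canonical model of GL *)

Lemma GL_modal_logic : modal_logic GL.
Proof. by case: (oplus_NExt K modal_logic_cap [set GL_axiom]). Qed.

Lemma K_sub_GL : K `<=` GL.
Proof. by case: (oplus_NExt K modal_logic_cap [set GL_axiom]). Qed.

Lemma GL_mp a b : GL a -> GL (MImp a b) -> GL b.
Proof. by have [_ _ h _] := GL_modal_logic; exact: h. Qed.

Lemma GL_nec a : GL a -> GL (MBox a).
Proof. by have [_ _ _ h] := GL_modal_logic; exact: h. Qed.

Lemma GL_subst s a : GL a -> GL (modal_subst s a).
Proof. by have [_ h _ _] := GL_modal_logic; exact: h. Qed.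

Lemma CPC_sub_GL : CPC `<=` GL.
Proof. by move=> a ta; apply: K_sub_GL; apply: sub_gen_smallest; left. Qed.

Lemma GL_box_distr a b :
  GL (MImp (MBox (MImp a b)) (MImp (MBox a) (MBox b))).
Proof.
have /GL_subst : GL modal_K_axiom.
  by apply: K_sub_GL; apply: sub_gen_smallest; right.
by move=> /(_ (fun n => if n is 0 then a else b)).
Qed.

Lemma GL_lob a : GL (MImp (MBox (MImp (MBox a) a)) (MBox a)).
Proof.
have /GL_subst : GL GL_axiom by apply: sub_gen_smallest; right.
by move=> /(_ (fun=> a)).
Qed.

Ltac tauto_CPC :=
  let v := fresh in let w := fresh in
  apply: CPC_sub_GL => v w /=;
  repeat match goal with |- context [bool_eval v w ?a] =>
    case: (bool_eval v w a) => //= end;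
  repeat match goal with |- context [w ?a] => case: (w a) => //= end.

(* As [GL] contains excluded middle, its prime theories are exactly its maximal
   consistent sets. *)
Definition mcs : set (set modal) := prime_theory MImp MOr GL.

Lemma GL_weak a b : GL (MImp a (MImp b a)). Proof. tauto_CPC. Qed.
Lemma GL_distr a b c : GL (MImp (MImp a (MImp b c)) (MImp (MImp a b) (MImp a c))).
Proof. tauto_CPC. Qed.
Lemma GL_or a b c : GL (MImp (MImp a c) (MImp (MImp b c) (MImp (MOr a b) c))).
Proof. tauto_CPC. Qed.

Lemma theory_avoid X a : theory MImp GL X -> ~ X a ->
  exists x, [/\ mcs x, X `<=` x & ~ x a].
Proof. exact: (prime_extension GL_weak GL_distr GL_or). Qed.

Lemma mcs_GL x a : mcs x -> GL a -> x a.
Proof. by move=> [[h _] _ _] /h. Qed.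

Lemma mcs_mp x a b : mcs x -> GL (MImp a b) -> x a -> x b.
Proof. by move=> [[h M] _ _] /h + xa; exact: M. Qed.

Lemma mcs_mp2 x a b c : mcs x -> GL (MImp a (MImp b c)) -> x a -> x b -> x c.
Proof. by move=> xx /(mcs_mp xx) h /h xbc xb; case: xx => [[_ M] _ _]; exact: M xb xbc. Qed.

Lemma mcs_bot x : mcs x -> ~ x MBot.
Proof.
move=> xx; have [_ [a na] _] := xx => xb.
by apply: na; apply: mcs_mp xb => //; tauto_CPC.
Qed.

Lemma mcs_top x : mcs x -> x MTop.
Proof. by move=> xx; apply: mcs_GL => //; tauto_CPC. Qed.

Lemma mcs_neg x a : mcs x -> x (MNeg a) <-> ~ x a.
Proof.
move=> xx; split=> [na xa|nxa].
  by apply: (mcs_bot xx); apply: mcs_mp2 na xa => //; tauto_CPC.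
have [_ _ /(_ a (MNeg a))[]//] := xx.
by apply: mcs_GL => //; tauto_CPC.
Qed.

Lemma mcs_and x a b : mcs x -> x (MAnd a b) <-> x a /\ x b.
Proof.
move=> xx; split=> [xab|[xa xb]]; last by apply: mcs_mp2 xa xb => //; tauto_CPC.
by split; apply: mcs_mp xab => //; tauto_CPC.
Qed.

Lemma mcs_or x a b : mcs x -> x (MOr a b) <-> x a \/ x b.
Proof.
move=> xx; split=> [xab|[]]; first by have [_ _] := xx; exact.
  by apply: mcs_mp => //; tauto_CPC.
by apply: mcs_mp => //; tauto_CPC.
Qed.

Lemma mcs_imp x a b : mcs x -> x (MImp a b) <-> (x a -> x b).
Proof.
move=> xx; rewrite /MImp mcs_or// mcs_neg//; split=> [[na|xb] xa//|h].
by have [/h|] := pselect (x a); [right|left].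
Qed.

Lemma GL_mcs a : GL a <-> forall x, mcs x -> x a.
Proof.
split=> [ga x xx|h]; first exact: mcs_GL.
apply: contrapT => nga.
have [|x [xx _]] := @theory_avoid GL a _ nga; last by apply; exact: h.
by split=> // b c; exact: GL_mp.
Qed.

(** * The accessibility relation and its transitivity *)

Definition rel (x y : set modal) : Prop := forall a, x (MBox a) -> y a.

(** By necessitation and distribution the formulae whose box lies in [x] form a theory; if it omits
    [a], so does some point extending it. *)
Lemma mcs_box x a : mcs x ->
  x (MBox a) <-> forall y, mcs y -> rel x y -> y a.
Proof.
move=> xx; split=> [xa y _|h]; first exact.
apply: contrapT => nxa.
have [|y [yy xy nya]] := @theory_avoid [set b | x (MBox b)] a _ nxa.
  split=> [b gb|b c /= xb xbc]; first exact: mcs_GL xx (GL_nec gb).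
  exact: mcs_mp2 (GL_box_distr b c) xbc xb.
by apply: nya; apply: h.
Qed.

(** If every successor satisfied [MImp (MBox a) a], Loeb's axiom would put [MBox a] in [x]. *)
Lemma mcs_box_lob x a : mcs x -> ~ x (MBox a) ->
  exists y, [/\ mcs y, rel x y, y (MBox a) & ~ y a].
Proof.
move=> xx nxa; apply: contrapT => h; apply: nxa.
apply: (mcs_mp xx (GL_lob a)); apply/mcs_box => // y yy xy.
by apply/mcs_imp => // yb; apply: contrapT => nya; apply: h; exists y.
Qed.

(** Transitivity comes from Loeb's axiom for [MAnd (MBox a) a]: a successor of [x] that satisfies
    the box of this conjunction also satisfies the conjunction. *)
Lemma rel_box x y a : mcs x -> mcs y -> rel x y -> x (MBox a) -> y (MBox a).
Proof.
move=> xx yy xy xa.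
suff : x (MBox (MAnd (MBox a) a)) by move=> /xy/mcs_and-[].
apply: contrapT => /(mcs_box_lob xx)[z [zz xz za nz]].
apply: nz; apply/mcs_and => //; split; last exact: xz.
by apply/mcs_box => // u uu zu; have /mcs_and[] := zu _ za.
Qed.

Lemma rel_trans x y z : mcs x -> mcs y -> rel x y -> rel y z -> rel x z.
Proof. by move=> xx yy xy yz a /(rel_box xx yy xy)/yz. Qed.

Definition le (x y : set modal) : Prop := x = y \/ rel x y.

Lemma le_refl x : le x x. Proof. by left. Qed.

Lemma le_trans x y z : mcs x -> mcs y -> le x y -> le y z -> le x z.
Proof.
move=> xx yy [->//|xy] [<-|yz]; first by right.
by right; exact: rel_trans xy yz.
Qed.

Lemma rel_le_trans x y z : mcs x -> mcs y -> rel x y -> le y z -> rel x z.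
Proof. by move=> xx yy xy [<-//|yz]; exact: rel_trans xy yz. Qed.

Lemma mcs_boxplus x a : mcs x ->
  x (MBoxPlus a) <-> forall y, mcs y -> le x y -> y a.
Proof.
move=> xx; rewrite /MBoxPlus mcs_and// mcs_box//; split=> [[h xa] y yy [<-//|]|h].
  exact: h.
by split=> [y yy xy|]; apply: h => //; [right|left].
Qed.

(** * Persistence and soundness of the translation *)

Lemma T_persistent a x y : mcs x -> mcs y -> le x y -> x (T a) -> y (T a).
Proof.
elim: a x y => [n|||a IHa b IHb|a IHa b IHb|a IHa b IHb|a IHa] x y xx yy xy /=.
- rewrite !mcs_boxplus// => h z zz yz; apply: h => //; exact: le_trans yz.
- by case: xy => [->//|_ /(mcs_bot xx)].
- by move=> _; exact: mcs_top.
- by rewrite !mcs_and// => -[xa xb]; split; [exact: IHa xa|exact: IHb xb].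
- by rewrite !mcs_or// => -[xa|xb]; [left; exact: IHa xa|right; exact: IHb xb].
- rewrite !mcs_boxplus// => h z zz yz; apply: h => //; exact: le_trans yz.
- rewrite !mcs_box// => h z zz yz; apply: h => //.
  by case: xy => [->//|xy]; exact: rel_trans yz.
Qed.

Lemma mcs_T_imp x a b : mcs x ->
  x (T (IImp a b)) <-> forall y, mcs y -> le x y -> y (T a) -> y (T b).
Proof.
move=> xx /=; rewrite mcs_boxplus//; split=> h y yy xy.
  by apply/mcs_imp => //; exact: h.
by apply/mcs_imp => //; exact: h.
Qed.

Lemma mcs_boxplus_T x a : mcs x -> x (MBoxPlus (T a)) <-> x (T a).
Proof.
move=> xx; rewrite mcs_boxplus//; split=> [h|xa y yy xy].
  by apply: h => //; exact: le_refl.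
exact: T_persistent xy xa.
Qed.

(** The two sides differ by a [MBoxPlus] in front of each [T (s n)], which persistence makes
    harmless. *)
Lemma T_subst s a x : mcs x ->
  x (T (msi_subst s a)) <-> x (modal_subst (fun n => T (s n)) (T a)).
Proof.
elim: a x => [n|||a IHa b IHb|a IHa b IHb|a IHa b IHb|a IHa] x xx /=.
- by rewrite -[MAnd _ _]/(MBoxPlus _) mcs_boxplus_T.
- by [].
- by [].
- by rewrite !mcs_and// IHa// IHb.
- by rewrite !mcs_or// IHa// IHb.
- rewrite -![MAnd _ _]/(MBoxPlus _) !mcs_boxplus//; split=> h y yy xy;
  by have := h y yy xy; rewrite !mcs_or// !mcs_neg// IHa// IHb.
- by rewrite !mcs_box//; split=> h y yy xy; have := h y yy xy; rewrite IHa.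
Qed.

Lemma GL_T_imp a b :
  (forall x, mcs x -> x (T a) -> x (T b)) -> GL (T (IImp a b)).
Proof. by move=> h; apply/GL_mcs => x xx; apply/mcs_T_imp => // y yy _; exact: h. Qed.

Lemma mcs_T_mp x a b : mcs x -> x (T (IImp a b)) -> x (T a) -> x (T b).
Proof. by move=> xx /(mcs_T_imp _ _ xx); apply=> //; exact: le_refl. Qed.

Lemma T_IPC_axioms a : IPC_axioms a -> GL (T a).
Proof.
rewrite /IPC_axioms /= !inE.
have W y z c : mcs y -> mcs z -> le y z -> y (T c) -> z (T c).
  by move=> yy zz; exact: T_persistent.
repeat (case/predU1P=> [->|]); last move=> /eqP->.
- apply: GL_T_imp => x xx xp; apply/mcs_T_imp => // y yy xy _; exact: W xp.
- apply: GL_T_imp => x xx xpqr; apply/mcs_T_imp => // y yy xy ypq.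
  apply/mcs_T_imp => // z zz yz zp.
  apply: (mcs_T_mp zz _ (mcs_T_mp zz (W y z _ yy zz yz ypq) zp)).
  exact: (mcs_T_mp zz (W y z _ yy zz yz (W x y _ xx yy xy xpqr)) zp).
- by apply: GL_T_imp => x xx /(mcs_and _ _ xx)[].
- by apply: GL_T_imp => x xx /(mcs_and _ _ xx)[].
- apply: GL_T_imp => x xx xp; apply/mcs_T_imp => // y yy xy yq.
  by apply/mcs_and => //; split=> //; exact: W xp.
- by apply: GL_T_imp => x xx xp; apply/mcs_or => //; left.
- by apply: GL_T_imp => x xx xp; apply/mcs_or => //; right.
- apply: GL_T_imp => x xx xpr; apply/mcs_T_imp => // y yy xy yqr.
  apply/mcs_T_imp => // z zz yz /(mcs_or _ _ zz)[zp|zq].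
    exact: (mcs_T_mp zz (W y z _ yy zz yz (W x y _ xx yy xy xpr)) zp).
  exact: (mcs_T_mp zz (W y z _ yy zz yz yqr) zq).
- by apply: GL_T_imp => x xx /(mcs_bot xx).
- by apply/GL_mcs => x; exact: mcs_top.
Qed.

Lemma T_K_axiom : GL (T msi_K_axiom).
Proof.
apply: GL_T_imp => x xx xpq; apply/mcs_T_imp => // y yy xy yp.
apply/mcs_box => // z zz yz; have := @T_persistent (IBox (IImp (IVar 0) (IVar 1))) x y xx yy xy xpq.
by move=> /yz zpq; exact: (@mcs_T_mp z (IVar 0) (IVar 1) zz zpq (yz _ yp)).
Qed.

Lemma T_KM_axioms a : KM_axioms a -> GL (T a).
Proof.
move=> [[->|->]|->].
- apply: GL_T_imp => x xx xp; apply/mcs_box => // y yy xy.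
  by apply: T_persistent xp => //; right.
(* By the premise it suffices to derive the box at [x]; if it failed, some successor would satisfy
   the box but not the variable, against the persistent premise. *)
- apply: GL_T_imp => x xx xp; apply: (mcs_T_mp xx xp); apply: contrapT.
  move=> /(mcs_box_lob xx)[y [yy xy yb nyb]]; apply: nyb.
  apply: (@mcs_T_mp y (IBox (IVar 0)) (IVar 0) yy _ yb).
  by apply: T_persistent xp => //; right.
(* If the second variable fails at [x], the implication concerns proper successors only, where the
   box gives the first. *)
- apply: GL_T_imp => x xx /(mcs_box _ xx) xp; apply/mcs_or => //.
  have [|nq] := pselect (x (T (IVar 1))); [by left|right].
  by apply/(@mcs_T_imp x (IVar 1) (IVar 0) xx) => y yy [<-//|xy] _; exact: xp.
Qed.

(** * Order isomorphisms and rule systems *)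

Section OrderIsomorphisms.
Variables (U V : Type) (C : set (set U)) (X : set U).
Variables (D : set (set V)) (Y : set V).
Hypotheses (Ccap : intersection_closed C) (Dcap : intersection_closed D).

(** Meets and joins are determined by the order, which [f] and its inverse [g] preserve. *)
Lemma order_iso_morphism (f : set U -> set V) (g : set V -> set U) :
  set_fun (NExt C X) (NExt D Y) f -> set_fun (NExt D Y) (NExt C X) g ->
  {homo f : A B / A `<=` B} -> {homo g : A B / A `<=` B} ->
  (forall L, NExt C X L -> g (f L) = L) ->
  (forall M, NExt D Y M -> f (g M) = M) ->
  complete_lattice_morphism C X D Y f.
Proof.
move=> fN gN fle gle fK gK; split=> // F FN.
  have FfN : f @` F `<=` NExt D Y by move=> _ [L /FN NL <-]; exact: fN.
  have [_ lb glb] := nmeet_glb Ccap FN.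
  have [Nf lbf glbf] := nmeet_glb Dcap FfN.
  apply/seteqP; split.
    by apply: glbf => _ [L FL <-]; apply: fle; exact: lb.
  rewrite -[X in X `<=` _]gK//; apply: fle; apply: glb => L FL.
  by rewrite -[L]fK; [by apply: gle; apply: lbf; exists L|exact: FN].
have FfN : f @` F `<=` NExt D Y by move=> _ [L /FN NL <-]; exact: fN.
have [N ub lub] := njoin_lub Ccap FN.
have [Nf ubf lubf] := njoin_lub Dcap FfN.
apply/seteqP; split.
  rewrite -[X in _ `<=` X]gK//; apply: fle; apply: lub => [|L FL]; first exact: gN.
  by rewrite -[L]fK; [by apply: gle; apply: ubf; exists L|exact: FN].
apply: lubf => [|_ [L FL <-]]; first exact: fN.
by apply: fle; exact: ub.
Qed.

End OrderIsomorphisms.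

Lemma order_isos (U V : Type) (C : set (set U)) (X : set U)
    (D : set (set V)) (Y : set V) (f : set U -> set V) (g : set V -> set U) :
  intersection_closed C -> intersection_closed D ->
  set_fun (NExt C X) (NExt D Y) f -> set_fun (NExt D Y) (NExt C X) g ->
  {homo f : A B / A `<=` B} -> {homo g : A B / A `<=` B} ->
  (forall L, NExt C X L -> g (f L) = L) ->
  (forall M, NExt D Y M -> f (g M) = M) ->
  mutually_inverse_complete_lattice_isos C X D Y f g.
Proof.
by move=> Ccap Dcap fN gN fle gle fK gK; split=> //;
   [exact: (order_iso_morphism Ccap Dcap fN gN)
   |exact: (order_iso_morphism Dcap Ccap gN fN)].
Qed.

Lemma oplus_mono U (C : set (set U)) X A B : A `<=` B -> oplus C X A `<=` oplus C X B.
Proof.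
move=> AB a h L [CL XB]; apply: h; split=> //.
by apply: subset_trans XB; exact: setUS.
Qed.

Section RuleSystems.
Variables (F : choiceType) (subst : (nat -> F) -> F -> F) (S : set (rule F)).
Hypothesis SS : rule_system subst S.
Implicit Types (A B G D : {fset F}).

Lemma rule_weaken A B G D : (A `<=` G)%fset -> (B `<=` D)%fset ->
  S (A, B) -> S (G, D).
Proof.
move=> AG BD; have [_ _ W _] := SS => /(W _ _ G D).
by move/fsetUidPr: AG => ->; move/fsetUidPr: BD => ->.
Qed.

Lemma rule_cut_premises A G D : S (A, D) ->
  (forall a, a \in A -> S (G, [fset a]%fset)) -> S (G, D).
Proof.
move=> SA GA.
(* Induction on a list [s] of premises still to be cut; all other premises in [B] lie in [G]. *)
suff {SA GA} main (s : seq F) : forall B, S (B, D) ->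
    (forall a, a \in s -> S (G, [fset a]%fset)) ->
    {subset B <= s ++ G} -> S (G, D).
  by apply: (main (enum_fset A) _ SA) => [a /GA//|a aA]; rewrite mem_cat aA.
have [_ _ _ cut] := SS.
elim: s => [|b s IH] B SB sG Bs.
  by apply: rule_weaken SB => //; apply/fsubsetP.
apply: (IH ((B `\ b) `|` G)%fset) => [|a as_|a]; last 2 first.
- by apply: sG; rewrite inE as_ orbT.
- rewrite !inE mem_cat => /orP[/andP[ab /Bs]|->]; last by rewrite orbT.
  by rewrite /= inE mem_cat (negbTE ab).
apply: (cut _ _ b).
  apply: rule_weaken (sG b (mem_head _ _)); first exact: fsubsetUr.
  by rewrite fsub1set !inE eqxx.
apply: rule_weaken SB => //; apply/fsubsetP => a aB.
by rewrite !inE aB andbT; case: (a == b).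
Qed.

Lemma rule_cut_conclusions B G D : S (G, B) ->
  (forall b, b \in B -> S ([fset b]%fset, D)) -> S (G, D).
Proof.
move=> SB BD.
suff {SB BD} main (s : seq F) : forall A, S (G, A) ->
    (forall a, a \in s -> S ([fset a]%fset, D)) ->
    {subset A <= s ++ D} -> S (G, D).
  by apply: (main (enum_fset B) _ SB) => [a /BD//|a aA]; rewrite mem_cat aA.
have [_ _ _ cut] := SS.
elim: s => [|b s IH] A SA sD As.
  by apply: rule_weaken SA => //; apply/fsubsetP.
apply: (IH ((A `\ b) `|` D)%fset) => [|a as_|a]; last 2 first.
- by apply: sD; rewrite inE as_ orbT.
- rewrite !inE mem_cat => /orP[/andP[ab /As]|->]; last by rewrite orbT.
  by rewrite /= inE mem_cat (negbTE ab).
apply: (cut _ _ b).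
  apply: rule_weaken SA => //; apply/fsubsetP => a aA.
  by rewrite !inE aA andbT; case: (a == b).
apply: rule_weaken (sD b (mem_head _ _)); last exact: fsubsetUr.
by rewrite fsub1set !inE eqxx.
Qed.

Lemma rule_axiom G a : S (axiom_rule a) -> S (G, [fset a]%fset).
Proof. exact: rule_weaken. Qed.

Lemma rule_detach G a b c : S ([fset a; b]%fset, [fset c]%fset) ->
  S (G, [fset a]%fset) -> S (G, [fset b]%fset) -> S (G, [fset c]%fset).
Proof.
move=> abc Ga Gb; apply: rule_cut_premises abc _ => d.
by rewrite !inE => /orP[]/eqP->.
Qed.

(** Cuts lead from [g a] to [f a] in the premises and from [f a] to [g a] in the conclusions, hence
    the opposite directions of the two hypotheses. *)
Lemma rule_transfer (E : choiceType) (f g : E -> F) (r : rule E) :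
  (forall a, a \in r.1 -> S ([fset g a]%fset, [fset f a]%fset)) ->
  (forall a, a \in r.2 -> S ([fset f a]%fset, [fset g a]%fset)) ->
  S (map_rule f r) -> S (map_rule g r).
Proof.
case: r => G D /= gf fg SGD.
apply: (@rule_cut_conclusions [fset f x | x in D]%fset).
  apply: rule_cut_premises SGD _ => _ /imfsetP[a aG ->].
  apply: rule_weaken (gf a aG) => //.
  by rewrite fsub1set; apply/imfsetP; exists a.
move=> _ /imfsetP[a aD ->]; apply: rule_weaken (fg a aD) => //.
by rewrite fsub1set; apply/imfsetP; exists a.
Qed.

End RuleSystems.

Lemma map_rule_comp (E F G : choiceType) (f : E -> F) (g : F -> G) (r : rule E) :
  map_rule g (map_rule f r) = map_rule (g \o f) r.
Proof.
have comp (A : {fset E}) :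
    [fset g x | x in [fset f y | y in A]]%fset = [fset (g \o f) x | x in A]%fset.
  by rewrite -imfset_comp.
by rewrite /map_rule /= !comp.
Qed.

Lemma map_rule_axiom (E F : choiceType) (f : E -> F) a :
  map_rule f (axiom_rule a) = axiom_rule (f a).
Proof. by rewrite /map_rule /axiom_rule /= imfset0 imfset_fset1. Qed.

Lemma rule_system_preimage (E F : choiceType) (substE : (nat -> E) -> E -> E)
    (substF : (nat -> F) -> F -> F) (f : E -> F) (S : set (rule F)) :
  rule_system substF S ->
  (forall s r, S (map_rule f r) -> S (map_rule f (map_rule (substE s) r))) ->
  rule_system substE [set r | S (map_rule f r)].
Proof.
move=> SS Ssub; split=> [//|a|G D G' D'|G D a]; have [_ R W C] := SS.
- by rewrite /map_rule /= imfset_fset1.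
- by rewrite /map_rule /= !imfsetU; exact: W.
- by rewrite /map_rule /= !imfsetU1; exact: C.
Qed.

(** * Derivability over GL and the maps rho *)

Section ModalRules.
Variable M : set (rule modal).
Hypotheses (MC : modal_rule_system M) (GLM : GL_R `<=` M).

Lemma modal_rule_GL G a : GL a -> M (G, [fset a]%fset).
Proof.
have [SM _ _ _] := MC; move=> ga; apply: (rule_axiom SM).
by apply: GLM; apply: sub_gen_smallest; exists a.
Qed.

(** Necessitation yields [MBox a] from the premise [a]. *)
Lemma modal_rule_boxplus a b :
  GL (MImp (MBoxPlus a) b) -> M ([fset a]%fset, [fset b]%fset).
Proof.
have [SM _ mp nec] := MC; have [_ refl _ _] := SM.
move=> gab; apply: (rule_detach SM (mp a b)); first exact: refl.
apply: (rule_detach SM (mp (MBox a) (MImp a b))); first exact: nec.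
apply: modal_rule_GL; apply: GL_mp gab _; rewrite /MBoxPlus; tauto_CPC.
Qed.

End ModalRules.

Lemma modal_logic_boxplus M a b : modal_logic M -> GL `<=` M ->
  GL (MImp (MBoxPlus a) b) -> M a -> M b.
Proof.
move=> [_ _ mp nec] GLM gab ma; apply: (mp _ _ _ (GLM _ gab)).
apply: (mp _ _ (nec _ ma)); apply: (mp _ _ ma); apply: GLM; rewrite /MBoxPlus; tauto_CPC.
Qed.

Lemma GL_boxplus_imp a b : (forall x, mcs x -> x a -> x b) -> GL (MImp (MBoxPlus a) b).
Proof.
move=> ab; apply/GL_mcs => x xx; apply/mcs_imp => // /(mcs_and _ _ xx)[_].
exact: ab.
Qed.

Lemma rho_logics_NExt M : NExt modal_logic GL M -> NExt msi_logic KM (rho_logics M).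
Proof.
move=> [MC GLM]; have [_ sub mp nec] := MC.
have rsub : msi_subst_closed (rho_logics M).
  move=> s a /= ma; apply: (modal_logic_boxplus MC GLM _ (sub (fun n => T (s n)) _ ma)).
  by apply: GL_boxplus_imp => x xx /(T_subst _ _ xx).
have rmp : msi_mp_closed (rho_logics M).
  move=> a b ma mab; apply: (mp _ _ ma); apply: (modal_logic_boxplus MC GLM _ mab).
  by apply: (@GL_boxplus_imp (T (IImp a b))) => x xx /(mcs_and _ _ xx)[].
have rnec : msi_nec_closed (rho_logics M) by move=> a; exact: nec.
have rC : msi_logic (rho_logics M).
  split=> //; apply: smallest_sub => // a [|->]; last by apply: GLM; exact: T_K_axiom.
  by move: a; apply: smallest_sub => // a /T_IPC_axioms/GLM.
split=> //; apply: smallest_sub => // a [|/T_KM_axioms/GLM//].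
by have [+ _ _ _] := rC; apply.
Qed.

(** * Prime theories of KM and the free Boolean extension *)

Lemma KM_msi_logic : msi_logic KM.
Proof. by case: (oplus_NExt IPCK msi_logic_cap KM_axioms). Qed.

Lemma IPCK_sub_KM : IPCK `<=` KM.
Proof. by case: (oplus_NExt IPCK msi_logic_cap KM_axioms). Qed.

Lemma T_KM a : KM a -> GL (T a).
Proof.
by move: a; have [] := @rho_logics_NExt GL (conj GL_modal_logic (@subset_refl _ GL)).
Qed.

Lemma rho_rules_NExt M : NExt modal_rule_system GL_R M ->
  NExt msi_rule_system KM_R (rho_rules M).
Proof.
move=> [MC GLM]; have [SM _ mp nec] := MC; have [sub refl _ _] := SM.
have rKM a : KM a -> rho_rules M (axiom_rule a).
  by move=> /T_KM ga; rewrite /rho_rules /= /T_rule map_rule_axiom; exact: modal_rule_GL.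
have rC : msi_rule_system (rho_rules M).
  split.
  - apply: (rule_system_preimage SM) => s r.
    move=> /(sub (fun n => T (s n))); rewrite !map_rule_comp.
    apply: (rule_transfer SM) => a _; apply: modal_rule_boxplus => //;
    by apply: GL_boxplus_imp => x xx /(T_subst _ _ xx).
  - by move=> a /IPCK_sub_KM; exact: rKM.
  - move=> a b; rewrite /rho_rules /= /T_rule /map_rule /= imfsetU !imfset_fset1.
    apply: (rule_detach SM (mp (T a) (T b))).
      by apply: (rule_weaken SM _ _ (refl (T a))) => //; exact: fsubsetUl.
    apply: (rule_weaken SM _ _ (modal_rule_boxplus MC GLM _)); last 2 first.
    - exact: fsubset_refl.
    - apply: (GL_boxplus_imp (a := T (IImp a b))) => x xx /(mcs_and _ _ xx)[_]; exact.
    exact: fsubsetUr.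
  - by move=> a; rewrite /rho_rules /= /T_rule /map_rule /= !imfset_fset1; exact: nec.
by split=> //; apply: smallest_sub => // _ [a KMa <-]; exact: rKM.
Qed.

Lemma KM_mp a b : KM a -> KM (IImp a b) -> KM b.
Proof. by have [_ _ h _] := KM_msi_logic; exact: h. Qed.

Lemma KM_nec a : KM a -> KM (IBox a).
Proof. by have [_ _ _ h] := KM_msi_logic; exact: h. Qed.

Lemma KM_subst s a : KM a -> KM (msi_subst s a).
Proof. by have [_ h _ _] := KM_msi_logic; exact: h. Qed.

Section KMInstances.
Let p := IVar 0.
Let q := IVar 1.
Let r := IVar 2.

(** The list [s] gives the formulae substituted for the first variables, in order; all further
    variables become [ITop]. *)
Let IPC_inst s d : IPC_axioms d -> KM (msi_subst (nth ITop s) d).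
Proof.
move=> dax; apply: KM_subst; apply: IPCK_sub_KM; apply: sub_gen_smallest; left.
exact: sub_gen_smallest.
Qed.

Let KM_inst s d : KM_axioms d -> KM (msi_subst (nth ITop s) d).
Proof. by move=> dax; apply: KM_subst; apply: sub_gen_smallest; right. Qed.

Lemma KM_weak a b : KM (IImp a (IImp b a)).
Proof. exact: (@IPC_inst [:: a; b] (IImp p (IImp q p))). Qed.

Lemma KM_distr a b c : KM (IImp (IImp a (IImp b c)) (IImp (IImp a b) (IImp a c))).
Proof.
exact: (@IPC_inst [:: a; b; c] (IImp (IImp p (IImp q r)) (IImp (IImp p q) (IImp p r)))).
Qed.

Lemma KM_andl a b : KM (IImp (IAnd a b) a).
Proof. exact: (@IPC_inst [:: a; b] (IImp (IAnd p q) p)). Qed.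

Lemma KM_andr a b : KM (IImp (IAnd a b) b).
Proof. exact: (@IPC_inst [:: a; b] (IImp (IAnd p q) q)). Qed.

Lemma KM_and a b : KM (IImp a (IImp b (IAnd a b))).
Proof. exact: (@IPC_inst [:: a; b] (IImp p (IImp q (IAnd p q)))). Qed.

Lemma KM_orl a b : KM (IImp a (IOr a b)).
Proof. exact: (@IPC_inst [:: a; b] (IImp p (IOr p q))). Qed.

Lemma KM_orr a b : KM (IImp b (IOr a b)).
Proof. exact: (@IPC_inst [:: a; b] (IImp q (IOr p q))). Qed.

Lemma KM_or a b c : KM (IImp (IImp a c) (IImp (IImp b c) (IImp (IOr a b) c))).
Proof.
exact: (@IPC_inst [:: a; b; c] (IImp (IImp p r) (IImp (IImp q r) (IImp (IOr p q) r)))).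
Qed.

Lemma KM_bot a : KM (IImp IBot a).
Proof. exact: (@IPC_inst [:: a] (IImp IBot p)). Qed.

Lemma KM_top : KM ITop.
Proof. exact: (@IPC_inst [::] ITop). Qed.

Lemma KM_box_distr a b : KM (IImp (IBox (IImp a b)) (IImp (IBox a) (IBox b))).
Proof.
apply: (@KM_subst (nth ITop [:: a; b]) msi_K_axiom); apply: IPCK_sub_KM.
by apply: sub_gen_smallest; right.
Qed.

Lemma KM_inflate a : KM (IImp a (IBox a)).
Proof. by apply: (@KM_inst [:: a] (IImp p (IBox p))); left; left. Qed.

Lemma KM_lob a : KM (IImp (IImp (IBox a) a) a).
Proof. by apply: (@KM_inst [:: a] (IImp (IImp (IBox p) p) p)); left; right. Qed.

Lemma KM_box_or a b : KM (IImp (IBox a) (IOr b (IImp b a))).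
Proof. by apply: (@KM_inst [:: a; b] (IImp (IBox p) (IOr q (IImp q p)))); right. Qed.

End KMInstances.

Definition KM_prime : set (set msi) := prime_theory IImp IOr KM.

Lemma prime_KM w a : KM_prime w -> KM a -> w a.
Proof. by move=> [[h _] _ _] /h. Qed.

Lemma prime_mp w a b : KM_prime w -> w (IImp a b) -> w a -> w b.
Proof. by move=> [[_ h] _ _] + wa; exact: h. Qed.

(** The Kripke clause for implication on prime theories ordered by inclusion. *)
Lemma prime_imp w a b : KM_prime w ->
  w (IImp a b) <-> forall u, KM_prime u -> w `<=` u -> u a -> u b.
Proof.
move=> pw; split=> [wab u pu wu|h]; first exact: prime_mp (wu _ wab).
apply: contrapT => nab; have [thw _ _] := pw.
have [u [pu wu ua nub]] := @prime_extension_imp _ _ IOr KM KM_weak KM_distr KM_or _ _ _ thw nab.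
by apply: nub; exact: h.
Qed.

Lemma KM_primeP a : KM a <-> forall w, KM_prime w -> w a.
Proof.
split=> [ka w pw|h]; first exact: prime_KM.
apply: contrapT => nka.
have thKM : theory IImp KM KM by split=> // b c; exact: KM_mp.
have [w [pw _]] := @prime_extension _ _ IOr KM KM_weak KM_distr KM_or _ _ thKM nka.
by apply; exact: h.
Qed.

Lemma KM_imp a b : (forall w, KM_prime w -> w a -> w b) -> KM (IImp a b).
Proof.
by move=> h; apply/KM_primeP => w pw; apply/prime_imp => // u pu _; exact: h.
Qed.

(** The modality is treated algebraically, as a monotone operation, rather than by an accessibility
    relation. *)
Lemma prime_box_mono w a b : KM_prime w -> (forall u, KM_prime u -> u a -> u b) ->
  w (IBox a) -> w (IBox b).
Proof.
move=> pw ab; apply: (prime_mp pw); apply: (prime_KM pw).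
by apply: (KM_mp _ (KM_box_distr _ _)); apply: KM_nec; exact: KM_imp.
Qed.

(** Such prime filters determine ultrafilters of the Boolean extension. Prime theories of KM and
    preimages under [T] of maximal consistent sets are of this kind. *)
Definition lattice_prime (P : set msi) : Prop :=
  [/\ P ITop, ~ P IBot, (forall a b, P (IAnd a b) <-> P a /\ P b)
    & (forall a b, P (IOr a b) <-> P a \/ P b)].

Lemma KM_prime_lattice w : KM_prime w -> lattice_prime w.
Proof.
move=> pw; have mp a b : KM (IImp a b) -> w a -> w b.
  by move=> /(prime_KM pw); exact: prime_mp.
split=> [||a b|a b].
- exact: prime_KM KM_top.
- by have [_ [a na] _] := pw => wb; apply: na; exact: mp (KM_bot a) wb.
- split=> [wab|[wa]]; first by split; apply: mp wab; [exact: KM_andl|exact: KM_andr].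
  by apply: prime_mp => //; apply: mp wa; exact: KM_and.
- split=> [|[]]; first by have [_ _] := pw; exact.
    by apply: mp; exact: KM_orl.
  by apply: mp; exact: KM_orr.
Qed.

Lemma mcs_lattice x : mcs x -> lattice_prime [set a | x (T a)].
Proof.
move=> xx; split=> [||a b|a b] /=; [exact: mcs_top|exact: mcs_bot| |].
- exact: mcs_and.
- exact: mcs_or.
Qed.

(* The list [:: (a1, b1); ...; (an, bn)] stands for the element
   (~ a1 \/ b1) /\ ... /\ (~ an \/ bn) of the free Boolean extension of the
   lattice of msi formulae. *)
Definition cnf : Type := seq (msi * msi).

Definition holds (P : set msi) (c : cnf) : Prop :=
  forall p, p \in c -> P p.1 -> P p.2.

(** Distributivity, with the disjunction of [~a \/ b] and [~c \/ d] written as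
    [~(a /\ c) \/ (b \/ d)]. *)
Definition cnf_or (c d : cnf) : cnf :=
  [seq (IAnd p.1 q.1, IOr p.2 q.2) | p <- c, q <- d].

(** A negated clause [a /\ ~b] is written as the two clauses [~ITop \/ a] and [~b \/ IBot]. *)
Definition cnf_neg (c : cnf) : cnf :=
  foldr (fun p => cnf_or [:: (ITop, p.1); (p.2, IBot)]) [:: (ITop, IBot)] c.

Definition cnf_interior (c : cnf) : msi :=
  foldr (fun p => IAnd (IImp p.1 p.2)) ITop c.

Fixpoint cnf_eval (v : nat -> cnf) (a : modal) : cnf :=
  match a with
  | MVar n => v n
  | MBot => [:: (ITop, IBot)]
  | MTop => [::]
  | MAnd b c => cnf_eval v b ++ cnf_eval v c
  | MOr b c => cnf_or (cnf_eval v b) (cnf_eval v c)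
  | MNeg b => cnf_neg (cnf_eval v b)
  | MBox b => [:: (ITop, IBox (cnf_interior (cnf_eval v b)))]
  end.

Lemma cnf_eval_subst v s a :
  cnf_eval v (modal_subst s a) = cnf_eval (fun n => cnf_eval v (s n)) a.
Proof. by elim: a => //= [b -> c ->|b -> c ->|b ->|b ->]. Qed.

Section Holds.
Variable P : set msi.
Hypothesis PP : lattice_prime P.

Lemma holds_nil : holds P [::].
Proof. by []. Qed.

Lemma holds_cons p c : holds P (p :: c) <-> (P p.1 -> P p.2) /\ holds P c.
Proof.
split=> [h|[hp hc] q]; last by rewrite inE => /predU1P[->|/hc].
by split=> [|q qc]; apply: h; rewrite inE ?eqxx// qc orbT.
Qed.

Lemma holds_unit a : holds P [:: (ITop, a)] <-> P a.
Proof.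
have [top _ _ _] := PP.
by rewrite holds_cons /=; split=> [[/(_ top)]|].
Qed.

Lemma holds_cat c d : holds P (c ++ d) <-> holds P c /\ holds P d.
Proof.
split=> [h|[hc hd] p]; last by rewrite mem_cat => /orP[/hc|/hd].
by split=> p pc; apply: h; rewrite mem_cat pc ?orbT.
Qed.

Lemma holds_or c d : holds P (cnf_or c d) <-> holds P c \/ holds P d.
Proof.
have [_ _ Pand Por] := PP; split=> [h|hcd _ /allpairsP[[p q] /= [pc qd ->]] /=].
  apply: contrapT => /not_orP[]; rewrite /holds.
  move=> /existsNP[p /not_implyP[pc /not_implyP[p1 p2]]].
  move=> /existsNP[q /not_implyP[qd /not_implyP[q1 q2]]].
  have /h /= := allpairs_f (fun p q => (IAnd p.1 q.1, IOr p.2 q.2)) pc qd.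
  by rewrite Pand Por => /(_ (conj p1 q1))[].
rewrite Pand Por => -[p1 q1].
by case: hcd => [/(_ _ pc p1)|/(_ _ qd q1)]; [left|right].
Qed.

Lemma holds_neg c : holds P (cnf_neg c) <-> ~ holds P c.
Proof.
have [top bot _ _] := PP; elim: c => [|p c IH] /=.
  by rewrite holds_unit; split=> // /(_ holds_nil).
rewrite holds_or IH !holds_cons /=; split=> [[[h1 [h2 _]] [h3 _]|nc [_]//]|].
  exact/bot/h2/h3/h1.
move=> /not_andP[/not_implyP[p1 p2]|]; [left|by right].
by split=> //; split=> // /p2.
Qed.

Lemma holds_bot : ~ holds P [:: (ITop, IBot)].
Proof. by rewrite holds_unit; case: PP. Qed.

Lemma holds_imp v a b : holds P (cnf_eval v (MImp a b)) <->
  (holds P (cnf_eval v a) -> holds P (cnf_eval v b)).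
Proof.
rewrite /= holds_or holds_neg; split=> [[]//|h].
by have [/h|] := pselect (holds P (cnf_eval v a)); [right|left].
Qed.

(** At a prime filter the interpretation is a classical valuation with boxed formulae as atoms;
    hence tautologies are interpreted by elements that hold everywhere. *)
Lemma holds_bool_eval v a : holds P (cnf_eval v a) <->
  bool_eval (fun n => `[< holds P (v n) >])
    (fun b => `[< P (IBox (cnf_interior (cnf_eval v b))) >]) a.
Proof.
elim: a => [n|||a IHa b IHb|a IHa b IHb|a IHa|a IHa] /=.
- by rewrite asboolE.
- by split=> // /holds_bot.
- by split=> // _; exact: holds_nil.
- by rewrite holds_cat IHa IHb; split=> [/andP|/andP].
- by rewrite holds_or IHa IHb; split=> [/orP|/orP].
- by rewrite holds_neg IHa; split=> [/negP|/negP].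
- by rewrite holds_unit asboolE.
Qed.

End Holds.

Lemma prime_interior w c : KM_prime w ->
  w (cnf_interior c) <-> forall u, KM_prime u -> w `<=` u -> holds u c.
Proof.
move=> pw; have [top _ Pand _] := KM_prime_lattice pw.
elim: c => [|p c IH] /=; first by split=> // _ u _ _; exact: holds_nil.
rewrite Pand prime_imp// IH; split=> [[h1 h2] u pu wu|h].
  by apply/holds_cons; split; [exact: h1|exact: h2].
by split=> u pu wu; have /holds_cons[] := h u pu wu.
Qed.

Lemma KM_interior c : KM (cnf_interior c) <-> forall w, KM_prime w -> holds w c.
Proof.
split=> [/KM_primeP h w pw|h].
  by have /prime_interior := h _ pw; apply=> //; exact: subset_refl.
by apply/KM_primeP => w pw; apply/prime_interior => // u pu _; exact: h.
Qed.

(** In the Boolean extension, an element met with its box is its interior. This is where the third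
    KM axiom enters. *)
Lemma prime_boxplus w c : KM_prime w ->
  w (IBox (cnf_interior c)) /\ holds w c <-> w (cnf_interior c).
Proof.
move=> pw; have [top _ Pand Por] := KM_prime_lattice pw.
split=> [[wc hc]|wc]; last first.
  split; first exact: prime_mp (prime_KM pw (KM_inflate _)) wc.
  by move/prime_interior: wc; apply=> //; exact: subset_refl.
elim: c wc hc => [|[a b] c IH] //= wc /holds_cons[/= ab hc].
have wab : w (IBox (IImp a b)).
  apply: prime_box_mono wc => // u /KM_prime_lattice[_ _ + _].
  by move=> uand /uand[].
apply/Pand; split; last first.
  apply: IH => //; apply: prime_box_mono wc => // u /KM_prime_lattice[_ _ + _].
  by move=> uand /uand[].
(* In the prime theory w, the axiom for [IBox (a -> b)] decides a. *)
have /Por[wa|] := prime_mp pw (prime_KM pw (KM_box_or (IImp a b) a)) wab.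
  by apply/prime_imp => // u pu wu _; exact/wu/ab.
move=> /(prime_imp _ _ pw) h; apply/prime_imp => // u pu wu ua.
exact: prime_mp (h u pu wu ua) ua.
Qed.

Lemma holds_boxplus w v a : KM_prime w ->
  holds w (cnf_eval v (MBoxPlus a)) <-> w (cnf_interior (cnf_eval v a)).
Proof.
move=> pw; rewrite [cnf_eval _ _]/= -cat1s !holds_cat holds_unit.
  exact: prime_boxplus.
exact: KM_prime_lattice.
Qed.

(** As [MBoxPlus] is interpreted by the interior, translated formulae denote open elements, and only
    the interiors of the values [v n] enter. *)
Lemma holds_T w v a : KM_prime w -> holds w (cnf_eval v (T a)) <->
  w (msi_subst (fun n => cnf_interior (v n)) a).
Proof.
elim: a w => [n|||a IHa b IHb|a IHa b IHb|a IHa b IHb|a IHa] w pw;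
  have Pw := KM_prime_lattice pw; have [top bot Pand Por] := Pw.
- exact: holds_boxplus.
- by rewrite /= holds_unit.
- by [].
- by rewrite /= holds_cat Pand IHa// IHb.
- by rewrite /= holds_or// Por IHa// IHb.
- rewrite [T _]/= holds_boxplus// prime_interior// [msi_subst _ _]/= prime_imp//.
  by split=> h u pu wu; have := h u pu wu; rewrite -[MOr _ _]/(MImp _ _) holds_imp//;
    rewrite ?IHa ?IHb//; exact: KM_prime_lattice.
- rewrite /= holds_unit//; split; apply: prime_box_mono => // u pu.
    by move=> /(prime_interior _ pu) h; apply/IHa => //; exact: h.
  move=> ua; apply/prime_interior => // t pt ut; apply/IHa => //.
  exact: ut.
Qed.

(** * The interpretation of GL in KM *)

Definition msi_eval (v : nat -> cnf) (a : modal) : msi :=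
  cnf_interior (cnf_eval v a).

Definition interpreted_logic (L : set msi) : set modal :=
  [set a | forall v, L (msi_eval v a)].

Definition interpreted_rules (L : set (rule msi)) : set (rule modal) :=
  [set r | forall v, L (map_rule (msi_eval v) r)].

Lemma msi_eval_mp v a b :
  KM (IImp (msi_eval v a) (IImp (msi_eval v (MImp a b)) (msi_eval v b))).
Proof.
apply: KM_imp => w pw /(prime_interior _ pw) wa; apply/prime_imp => // u pu wu.
move=> /(prime_interior _ pu) uab; apply/prime_interior => // t pt ut.
have /(holds_imp (KM_prime_lattice pt)) := uab t pt ut; apply.
by apply: wa => //; exact: subset_trans ut.
Qed.

Lemma msi_eval_nec v a : KM (IImp (msi_eval v a) (msi_eval v (MBox a))).
Proof.
apply: KM_imp => w pw wa; apply/prime_interior => // u pu wu.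
apply/holds_unit; first exact: KM_prime_lattice.
exact: prime_mp (prime_KM pu (KM_inflate _)) (wu _ wa).
Qed.

Lemma interpreted_logic_closed L : msi_logic L -> KM `<=` L ->
  [/\ modal_subst_closed (interpreted_logic L),
      modal_mp_closed (interpreted_logic L)
    & modal_nec_closed (interpreted_logic L)].
Proof.
move=> [_ _ mp nec] KML; split=> [s a La v|a b La Lab v|a La v].
- by rewrite /msi_eval cnf_eval_subst; exact: La.
- by apply: (mp _ _ (Lab v)); apply: (mp _ _ (La v)); apply: KML; exact: msi_eval_mp.
- by apply: (mp _ _ (La v)); apply: KML; exact: msi_eval_nec.
Qed.

Lemma KM_eval_box_imp v a b :
  (forall w, KM_prime w -> w (msi_eval v a) -> w (msi_eval v b)) ->
  forall w, KM_prime w -> holds w (cnf_eval v (MImp (MBox a) (MBox b))).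
Proof.
move=> ab w pw; have Pw := KM_prime_lattice pw.
apply/holds_imp => //=; rewrite !holds_unit//; exact: prime_box_mono.
Qed.

Lemma GL_sub_interpreted_KM : GL `<=` interpreted_logic KM.
Proof.
have [sub mp nec] := interpreted_logic_closed KM_msi_logic (@subset_refl _ KM).
have KC : modal_logic (interpreted_logic KM).
  split=> //; apply: smallest_sub => // a [ta v|-> v].
    by apply/KM_interior => w /KM_prime_lattice Pw; apply/holds_bool_eval.
  apply/KM_interior => w pw; have Pw := KM_prime_lattice pw.
  apply/(holds_imp Pw) => /(holds_unit Pw) wab.
  apply/(holds_imp Pw) => /(holds_unit Pw) wa; apply/(holds_unit Pw).
  apply: (prime_mp pw (prime_mp pw (prime_KM pw (KM_box_distr _ _)) _) wa).
  apply: prime_box_mono wab => // u pu uab; apply/prime_imp => // t pt ut ta.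
  exact: (prime_mp pt (prime_mp pt (prime_KM pt (msi_eval_mp v (MVar 0) (MVar 1))) ta) (ut _ uab)).
apply: smallest_sub => // a [|-> v]; first by have [+ _ _ _] := KC; apply.
apply/KM_interior; apply: KM_eval_box_imp => w pw wh.
(* The axiom [(IBox p -> p) -> p] is used with the interior of the variable for [p]: above [w], the
   box of this interior yields the variable, hence its interior. *)
apply: (prime_mp pw (prime_KM pw (KM_lob _))); apply/prime_imp => // u pu wu ub.
apply/prime_interior => // t pt ut; have Pt := KM_prime_lattice pt.
have /prime_interior := wh => /(_ pw t pt (subset_trans wu ut)).
by move=> /(holds_imp Pt); apply; apply/holds_unit => //; exact: ut.
Qed.

Lemma sigma_logics_sub_interpreted L : NExt msi_logic KM L ->
  sigma_logics L `<=` interpreted_logic L.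
Proof.
move=> [LC KML]; have [sub mp nec] := interpreted_logic_closed LC KML.
have GLI : GL `<=` interpreted_logic L by move=> a /GL_sub_interpreted_KM h v; apply: KML; exact: h.
apply: smallest_sub; first by split=> // a /K_sub_GL/GLI.
move=> _ [/GLI//|[a La <-]] v; have [_ Lsub Lmp _] := LC.
(* The interpretation of [T a] follows from the instance of [a] in which each variable becomes the
   interior of its value. *)
apply: (Lmp _ _ (Lsub (fun n => cnf_interior (v n)) _ La)); apply: KML.
apply: KM_imp => w pw wa; apply/prime_interior => // u pu wu.
by apply/holds_T => //; exact: wu.
Qed.

(** * The generic valuation and the identity rho (sigma L) = L *)

Definition cnf_var (n : nat) : cnf := [:: (ITop, IVar n)].

(** Serves to replace the interior of [cnf_var n], which is [IVar n] only up to equivalence, by the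
    variable itself. *)
Lemma msi_subst_equiv s a w : KM_prime w ->
  (forall n u, KM_prime u -> u (s n) <-> u (IVar n)) ->
  w (msi_subst s a) <-> w a.
Proof.
move=> + sE; elim: a w => [n|||a IHa b IHb|a IHa b IHb|a IHa b IHb|a IHa] w pw //=;
  have [_ _ Pand Por] := KM_prime_lattice pw.
- exact: sE.
- by rewrite !Pand IHa// IHb.
- by rewrite !Por IHa// IHb.
- rewrite !prime_imp//; split=> h u pu wu; have := h u pu wu;
  by rewrite IHa// IHb.
- by split; apply: prime_box_mono => // u pu; rewrite IHa.
Qed.

Lemma prime_eval_T w a : KM_prime w -> w (msi_eval cnf_var (T a)) <-> w a.
Proof.
move=> pw; have sE n u : KM_prime u -> u (cnf_interior (cnf_var n)) <-> u (IVar n).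
  move=> pu; rewrite prime_interior//; split=> [h|un t pt ut].
    by apply/holds_unit; [exact: KM_prime_lattice|apply: h => //; exact: subset_refl].
  by apply/holds_unit; [exact: KM_prime_lattice|exact: ut].
rewrite -(@msi_subst_equiv _ a w pw sE) /msi_eval prime_interior//.
split=> [h|wa u pu wu]; last by apply/holds_T => //; exact: wu.
by apply/holds_T => //; apply: h => //; exact: subset_refl.
Qed.

Lemma rho_sigma_logics L : NExt msi_logic KM L -> rho_logics (sigma_logics L) = L.
Proof.
move=> NL; apply/seteqP; split=> a; last first.
  by move=> La; apply: sub_gen_smallest; right; exists a.
move=> /(sigma_logics_sub_interpreted NL)/(_ cnf_var); have [[_ _ mp _] KML] := NL.
by move=> La; apply: (mp _ _ La); apply: KML; apply: KM_imp => w pw /(prime_eval_T _ pw).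
Qed.

(** * The interpretation for rule systems *)

Section MsiRules.
Variable L : set (rule msi).
Hypotheses (LC : msi_rule_system L) (KML : KM_R `<=` L).

Lemma msi_rule_KM G a : KM a -> L (G, [fset a]%fset).
Proof.
have [SL _ _ _] := LC; move=> ka; apply: (rule_axiom SL).
by apply: KML; apply: sub_gen_smallest; exists a.
Qed.

Lemma msi_rule_imp a b : KM (IImp a b) -> L ([fset a]%fset, [fset b]%fset).
Proof.
have [SL _ mp _] := LC; have [_ refl _ _] := SL => kab.
by apply: (rule_detach SL (mp a b)); [exact: refl|exact: msi_rule_KM].
Qed.

Lemma interpreted_rules_closed :
  modal_rule_system (interpreted_rules L) /\ GL_R `<=` interpreted_rules L.
Proof.
have [SL _ mp nec] := LC; have [sub refl weak cut] := SL.
have GLI a : GL a -> interpreted_rules L (axiom_rule a).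
  move=> /GL_sub_interpreted_KM ga v; rewrite map_rule_axiom.
  by apply: KML; apply: sub_gen_smallest; exists (msi_eval v a).
have C : modal_rule_system (interpreted_rules L).
  split.
  - split=> [s r Lr v|a v|G D G' D' h v|G D a h1 h2 v].
    + rewrite map_rule_comp.
      have -> : msi_eval v \o modal_subst s = msi_eval (fun n => cnf_eval v (s n)).
        by apply/funext => a /=; rewrite /msi_eval cnf_eval_subst.
      exact: Lr.
    + by rewrite /map_rule /= imfset_fset1; exact: refl.
    + by rewrite /map_rule /= !imfsetU; apply: weak; exact: h.
    + have := h1 v; have := h2 v; rewrite /map_rule /= !imfsetU1 => ? ?.
      exact: (cut _ _ (msi_eval v a)).
  - by move=> a /K_sub_GL; exact: GLI.
  - move=> a b v; rewrite /map_rule /= imfsetU !imfset_fset1.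
    apply: (rule_detach SL (mp (msi_eval v (MImp a b)) (msi_eval v b))).
      by apply: (rule_weaken SL _ _ (refl (msi_eval v (MImp a b)))) => //; exact: fsubsetUr.
    apply: (rule_weaken SL _ _ (msi_rule_imp (msi_eval_mp v a b))) => //; exact: fsubsetUl.
  - move=> a v; rewrite /map_rule /= !imfset_fset1.
    exact: msi_rule_imp (msi_eval_nec v a).
by split=> //; apply: smallest_sub => // _ [a ga <-]; exact: GLI.
Qed.

Lemma sigma_rules_sub_interpreted : sigma_rules L `<=` interpreted_rules L.
Proof.
have [SL _ _ _] := LC; have [sub _ _ _] := SL.
have [C GLI] := interpreted_rules_closed.
apply: smallest_sub => // _ [/GLI//|[r Lr <-]] v; rewrite /T_rule map_rule_comp.
apply: (rule_transfer SL) (sub (fun n => cnf_interior (v n)) _ Lr) => a _;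
  apply: msi_rule_imp; apply: KM_imp => w pw; rewrite prime_interior//.
  by move=> h; apply/holds_T => //; apply: h => //; exact: subset_refl.
by move=> wa u pu wu; apply/holds_T => //; exact: wu.
Qed.

Lemma rho_sigma_rules : rho_rules (sigma_rules L) = L.
Proof.
have [SL _ _ _] := LC; apply/seteqP; split=> r; last first.
  by move=> Lr; apply: sub_gen_smallest; right; exists r.
move=> /sigma_rules_sub_interpreted/(_ cnf_var); rewrite /T_rule map_rule_comp => Lr.
have -> : r = map_rule id r.
  by case: r {Lr} => G D; rewrite /map_rule /= !imfset_id.
apply: (rule_transfer SL) Lr => a _; apply: msi_rule_imp; apply: KM_imp => w pw;
by move=> /(prime_eval_T _ pw).
Qed.

End MsiRules.

(** * Substitutions and types in the canonical model *)

Lemma modal_subst_comp f g a :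
  modal_subst f (modal_subst g a) = modal_subst (fun n => modal_subst f (g n)) a.
Proof. by elim: a => //= [b -> c ->|b -> c ->|b ->|b ->]. Qed.

Lemma mcs_subst s x : mcs x -> mcs [set a | x (modal_subst s a)].
Proof.
move=> xx; split=> [||a b]; last by move=> /(mcs_or _ _ xx).
  split=> [a ga|a b xa xab]; first exact: mcs_GL xx (GL_subst s ga).
  by move: xa; apply/(mcs_imp _ _ xx).
by exists MBot; move=> /(mcs_bot xx).
Qed.

Fixpoint subformulas (a : modal) : seq modal :=
  a :: match a with
       | MAnd b c | MOr b c => subformulas b ++ subformulas c
       | MNeg b | MBox b => subformulas b
       | _ => [::]
       end.

Lemma subformulas_refl a : a \in subformulas a.
Proof. by case: a => *; rewrite /= inE eqxx. Qed.

(** These conjunctions, one for each choice of signs, represent the types over [l]. *)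
Fixpoint sign_patterns (l : seq modal) : seq modal :=
  if l is a :: l' then
    [seq MAnd a c | c <- sign_patterns l'] ++
    [seq MAnd (MNeg a) c | c <- sign_patterns l']
  else [:: MTop].

Lemma sign_patterns_exist x l : mcs x -> exists2 c, c \in sign_patterns l & x c.
Proof.
move=> xx; elim: l => [|a l [c cl xc]] /=.
  by exists MTop; [exact: mem_head|exact: mcs_top].
have [xa|nxa] := pselect (x a).
  by exists (MAnd a c); [rewrite mem_cat map_f|exact/mcs_and].
exists (MAnd (MNeg a) c); first by rewrite mem_cat map_f// orbT.
by apply/mcs_and => //; split=> //; exact/mcs_neg.
Qed.

Lemma sign_patterns_agree x y l c : mcs x -> mcs y -> c \in sign_patterns l ->
  x c -> y c -> forall a, a \in l -> x a <-> y a.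
Proof.
move=> xx yy; elim: l c => // a l IH c /=; rewrite mem_cat.
move=> /orP[] /mapP[d dl ->] /(mcs_and _ _ xx)[xa xc] /(mcs_and _ _ yy)[ya yc] b;
  rewrite inE => /predU1P[->|/(IH d dl xc yc)//].
- by [].
- by move: xa ya; rewrite !mcs_neg.
Qed.

Lemma sign_patterns_inj x l c d : mcs x ->
  c \in sign_patterns l -> d \in sign_patterns l -> x c -> x d -> c = d.
Proof.
move=> xx; elim: l c d => [|a l IH] c d /=; first by rewrite !inE => /eqP-> /eqP->.
rewrite !mem_cat => /orP[] /mapP[c' cl ->] /orP[] /mapP[d' dl ->];
  move=> /(mcs_and _ _ xx)[xa xc] /(mcs_and _ _ xx)[xb xd].
- by rewrite (IH c' d').
- by move/(mcs_neg _ xx): xb.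
- by move/(mcs_neg _ xx): xa.
- by rewrite (IH c' d').
Qed.

Lemma mcs_bigor x l : mcs x ->
  x (foldr MOr MBot l) <-> exists2 c, c \in l & x c.
Proof.
move=> xx; elim: l => [|a l IH] /=.
  by split=> [/(mcs_bot xx)|[]].
rewrite mcs_or// IH; split=> [[xa|[c cl xc]]|[c]].
- by exists a; first exact: mem_head.
- by exists c; first by rewrite inE cl orbT.
- by rewrite inE => /predU1P[->|cl xc]; [left|right; exists c].
Qed.

Lemma mcs_boxplus_box x a : mcs x -> x (MBoxPlus (MBox a)) <-> x (MBox a).
Proof.
move=> xx; rewrite mcs_boxplus//; split=> [|xa y yy [<-//|xy]].
  by apply=> //; exact: le_refl.
exact: rel_box xy xa.
Qed.

Lemma mcs_boxplus_idem x a : mcs x -> x (MBoxPlus (MBoxPlus a)) <-> x (MBoxPlus a).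
Proof.
move=> xx; rewrite mcs_boxplus//; split=> [|].
  by apply=> //; exact: le_refl.
move=> /(mcs_boxplus _ xx) xa y yy xy; apply/mcs_boxplus => // z zz yz.
by apply: xa => //; exact: le_trans yz.
Qed.

Lemma mcs_T_interior x c : mcs x -> x (T (cnf_interior c)) <->
  forall y, mcs y -> le x y -> holds [set b | y (T b)] c.
Proof.
move=> xx; elim: c => [|p c IH].
  by split=> // _; exact: mcs_top.
rewrite [T _]/= mcs_and// IH -[MBoxPlus _]/(T (IImp p.1 p.2)) mcs_T_imp//.
split=> [[h1 h2] y yy xy|h].
  by apply/holds_cons; split; [exact: h1|exact: h2].
by split=> y yy xy; have /holds_cons[] := h y yy xy.
Qed.

(** The two readings differ at boxes, where the left one boxes the interior; by transitivity an
    element and its interior have the same box. *)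
Lemma holds_eval_var x a : mcs x ->
  holds [set b | x (T b)] (cnf_eval cnf_var a) <->
  x (modal_subst (fun n => T (IVar n)) a).
Proof.
elim: a x => [n|||a IHa b IHb|a IHa b IHb|a IHa|a IHa] x xx;
  have Px := mcs_lattice xx => /=.
- by rewrite holds_unit.
- by rewrite holds_unit.
- by split=> // _; exact: mcs_top.
- by rewrite holds_cat mcs_and// IHa// IHb.
- by rewrite holds_or// mcs_or// IHa// IHb.
- by rewrite holds_neg// mcs_neg// IHa.
- rewrite holds_unit//= !mcs_box//; split=> h y yy xy.
    by apply/IHa => //; move/mcs_T_interior: (h y yy xy); apply=> //; exact: le_refl.
  apply/mcs_T_interior => // z zz yz; apply/IHa => //; apply: h => //.
  exact: rel_le_trans yz.
Qed.

(** * Reduction of modal formulae to open elements *)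

Section Shadow.
Variable Phi : seq modal.

Definition modal_opens : seq modal :=
  [seq MBox (MNeg c) | c <- sign_patterns Phi] ++
  [seq MBoxPlus (MNeg c) | c <- sign_patterns Phi].

(* The open element o is represented by the variable of index [choice.pickle o];
   the names are qualified because finmap shadows them. *)
Definition open_subst (n : nat) : modal := odflt MTop (choice.unpickle n).

(** A profile fixes which open elements hold at a point, with variables as their names. *)
Definition profiles : seq modal :=
  sign_patterns [seq MVar (choice.pickle o) | o <- modal_opens].

(** The [MBoxPlus] is the one that [T] places on variables; it leaves the elements of [modal_opens]
    unchanged up to equivalence. *)
Let open_inst : modal -> modal := modal_subst (fun n => MBoxPlus (open_subst n)).

(** One point is chosen for each profile, so that shadows depend on the profile only; [setT] is the
    default for a profile that no point satisfies. *)
Definition representative (c : modal) : set modal :=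
  xget setT [set y | mcs y /\ y (open_inst c)].

(** Profiles being finite in number, truth of a variable at the shadow is definable by a disjunction
    of profiles. *)
Definition profile_subst (n : nat) : modal :=
  foldr MOr MBot [seq c <- profiles | `[< representative c (MVar n) >]].

Definition shadow (x : set modal) : set modal :=
  representative (xget MTop [set c | c \in profiles /\ x (open_inst c)]).

Lemma modal_opens_open x o : mcs x -> o \in modal_opens -> x (MBoxPlus o) <-> x o.
Proof.
move=> xx; rewrite mem_cat => /orP[] /mapP[c _ ->].
  exact: mcs_boxplus_box.
exact: mcs_boxplus_idem.
Qed.

(** The point [x] shows that its profile has a representative. Equal profiles give agreement on open
    elements, and as exactly one profile holds at [x], the disjunction [profile_subst n] decides the
    variable [n] at the shadow. *)
Lemma shadowP x : mcs x ->
  [/\ mcs (shadow x), forall o, o \in modal_opens -> x o <-> shadow x o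
    & forall n, x (open_inst (profile_subst n)) <-> shadow x (MVar n)].
Proof.
move=> xx; rewrite /shadow; set d := xget _ _.
have xx' := mcs_subst (fun n => MBoxPlus (open_subst n)) xx.
have [dP xd] : d \in profiles /\ x (open_inst d).
  have [c cP xc] := sign_patterns_exist [seq MVar (choice.pickle o) | o <- modal_opens] xx'.
  by apply: (@xgetPex _ MTop [set c | c \in profiles /\ x (open_inst c)]); exists c.
have [yy yd] : mcs (representative d) /\ representative d (open_inst d).
  by apply: (@xgetPex _ setT [set y | mcs y /\ y (open_inst d)]); exists x.
have yy' := mcs_subst (fun n => MBoxPlus (open_subst n)) yy.
split=> // [o oO|n].
  have : MVar (choice.pickle o) \in [seq MVar (choice.pickle o) | o <- modal_opens].
    exact: map_f.
  move=> /(sign_patterns_agree xx' yy' dP xd yd) /=.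
  rewrite /open_subst choice.pickleK.
  by rewrite !modal_opens_open.
have := mcs_bigor [seq c <- profiles | `[< representative c (MVar n) >]] xx'.
rewrite [X in X <-> _]/= => ->; split=> [[c]|yn]; last first.
  by exists d => //; rewrite mem_filter dP andbT; apply/asboolP.
rewrite mem_filter => /andP[/asboolP yn cP] xc.
by rewrite -(sign_patterns_inj xx' cP dP xc xd).
Qed.

(** The shadow agrees with [x] that [MBox (MNeg c)] holds and [MBoxPlus (MNeg c)] fails, which
    leaves only [c]. *)
Lemma shadow_last x c : mcs x -> c \in sign_patterns Phi -> x c -> x (MBox (MNeg c)) ->
  shadow x c.
Proof.
move=> xx cP xc xbc; have [yy yO _] := shadowP xx.
apply: contrapT => nyc.
have : x (MBoxPlus (MNeg c)).
  apply/yO; first by rewrite mem_cat [X in _ || X]map_f ?orbT.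
  apply/mcs_and => //; split; last exact/mcs_neg.
  by apply/yO => //; rewrite mem_cat map_f.
by move=> /(mcs_and _ _ xx)[_ /(mcs_neg _ xx)].
Qed.

(* Loeb's axiom provides the point y at which the type c occurs for the last time. *)
Lemma shadow_above x c : mcs x -> c \in sign_patterns Phi -> ~ x (MBox (MNeg c)) ->
  exists y, [/\ mcs y, rel x y, y c & shadow y c].
Proof.
move=> xx cP /(mcs_box_lob xx)[y [yy xy yb nyc]].
have yc : y c by apply: contrapT => nc; apply: nyc; exact/mcs_neg.
by exists y; split=> //; exact: shadow_last.
Qed.

(** Otherwise the open element [MBoxPlus (MNeg c)] would hold at [x] and so at its shadow. *)
Lemma shadow_realized x c : mcs x -> c \in sign_patterns Phi -> shadow x c ->
  exists y, [/\ mcs y, le x y & y c].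
Proof.
move=> xx cP sc; have [yy yO _] := shadowP xx; apply: contrapT => h.
have /yO : x (MBoxPlus (MNeg c)).
  apply/mcs_boxplus => // y my xy; apply/mcs_neg => // yc.
  by apply: h; exists y.
rewrite mem_cat [X in _ || X]map_f ?orbT// => /(_ isT)/(mcs_and _ _ yy)[_].
by move=> /(mcs_neg _ yy).
Qed.

Definition shadow_subst (n : nat) : modal := open_inst (profile_subst n).

Lemma shadow_truth a x : mcs x -> {subset subformulas a <= Phi} ->
  x (modal_subst shadow_subst a) <-> shadow x a.
Proof.
have subl (b c : modal) : {subset subformulas b ++ subformulas c <= Phi} ->
    {subset subformulas b <= Phi} /\ {subset subformulas c <= Phi}.
  by move=> h; split=> d dd; apply: h; rewrite mem_cat dd ?orbT.
have subt (b : modal) l : {subset b :: l <= Phi} -> {subset l <= Phi}.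
  by move=> h d dl; apply: h; rewrite inE dl orbT.
elim: a x => [n|||a IHa b IHb|a IHa b IHb|a IHa|a IHa] x xx aP;
  have [yy yO yV] := shadowP xx; move: aP => /=.
- by move=> _; exact: yV.
- by move=> _; split=> /mcs_bot; [move=> /(_ xx)|move=> /(_ yy)].
- by move=> _; split=> _; exact: mcs_top.
- by move=> /subt/subl[aP bP]; rewrite !mcs_and// IHa// IHb.
- by move=> /subt/subl[aP bP]; rewrite !mcs_or// IHa// IHb.
- by move=> /subt aP; rewrite !mcs_neg// IHa.
move=> /subt aP; have aPhi := aP _ (subformulas_refl a).
(* The type [c] of a successor [z] of the shadow is also seen from [x], hence it is the type of the
   shadow of some successor [t] of [x], to which the induction hypothesis applies. *)
split=> [/(mcs_box _ xx) h|sa].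
  apply/mcs_box => // z zz yz; apply: contrapT => nza.
  have [c cP zc] := sign_patterns_exist Phi zz.
  have /(shadow_above xx cP)[t [tt xt _ stc]] : ~ x (MBox (MNeg c)).
    move=> /yO; rewrite mem_cat map_f// => /(_ isT)/yz.
    by move=> /(mcs_neg _ zz).
  have [stt _ _] := shadowP tt.
  apply: nza; apply/(sign_patterns_agree stt zz cP stc zc aPhi).
  by apply/IHa => //; exact: h.
(* Conversely, the type of the shadow of [z] occurs at or above [z], so strictly above [x], and
   therefore also above the shadow of [x]. *)
apply/mcs_box => // z zz xz; apply/IHa => //; apply: contrapT => nza.
have [szz _ _] := shadowP zz.
have [c cP zc] := sign_patterns_exist Phi szz.
have [t [tt zt tc]] := shadow_realized zz cP zc.
have nyc : ~ shadow x (MBox (MNeg c)).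
  move=> /yO; rewrite mem_cat map_f// => /(_ isT) xc.
  by have /(mcs_neg _ tt) := rel_le_trans xx zz xz zt xc.
have [u uu [yu nuc]] : exists2 u, mcs u & rel (shadow x) u /\ ~ u (MNeg c).
  apply: contrapT => h; apply: nyc; apply/mcs_box => // u uu yu.
  by apply: contrapT => nu; apply: h; exists u.
have uc : u c by apply: contrapT => nc; apply: nuc; exact/mcs_neg.
apply: nza; apply/(sign_patterns_agree szz uu cP zc uc aPhi).
exact: yu.
Qed.

(** The type of the shadow of [x] occurs at or above [x], where [a] holds by assumption. *)
Lemma GL_shadow_subst a : {subset subformulas a <= Phi} ->
  GL (MImp (MBoxPlus a) (modal_subst shadow_subst a)).
Proof.
move=> aP; have aPhi := aP _ (subformulas_refl a).
apply/GL_mcs => x xx; apply/mcs_imp => // /(mcs_boxplus _ xx) xa.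
have [sxx _ _] := shadowP xx; apply/shadow_truth => //.
have [c cP sc] := sign_patterns_exist Phi sxx.
have [y [yy xy yc]] := shadow_realized xx cP sc.
apply/(sign_patterns_agree sxx yy cP sc yc aPhi).
exact: xa.
Qed.

(** The type of [x] is that of the shadow of [x] itself if it does not recur above [x], and of the
    shadow of a later point otherwise. *)
Lemma GL_shadow_subst_inv a : {subset subformulas a <= Phi} ->
  GL (MImp (MBoxPlus (modal_subst shadow_subst a)) a).
Proof.
move=> aP; have aPhi := aP _ (subformulas_refl a).
apply/GL_mcs => x xx; apply/mcs_imp => // /(mcs_boxplus _ xx) xa.
have [c cP xc] := sign_patterns_exist Phi xx.
have [y [yy xy syc]] : exists y, [/\ mcs y, le x y & shadow y c].
  have [xb|] := pselect (x (MBox (MNeg c))).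
    by exists x; split=> //; [exact: le_refl|exact: shadow_last].
  move=> /(shadow_above xx cP)[y [yy xy _ syc]]; exists y; split=> //.
  by right.
have [syy _ _] := shadowP yy.
apply/(sign_patterns_agree xx syy cP xc syc aPhi); apply/shadow_truth => //.
exact: xa.
Qed.

(** Its [T]-image amounts to the interior of [skeleton_subst a], which [open_subst] turns into the
    shadow instance of [a]. *)
Definition skeleton (a : modal) : msi :=
  msi_eval cnf_var (modal_subst profile_subst a).

Definition skeleton_subst (a : modal) : modal :=
  modal_subst (fun n => T (IVar n)) (modal_subst profile_subst a).

Lemma skeleton_subst_inst a :
  modal_subst open_subst (skeleton_subst a) = modal_subst shadow_subst a.
Proof. by rewrite /skeleton_subst !modal_subst_comp. Qed.

Lemma T_skeleton x a : mcs x ->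
  x (T (skeleton a)) <-> x (MBoxPlus (skeleton_subst a)).
Proof.
move=> xx; rewrite mcs_T_interior// mcs_boxplus//.
by split=> h y yy xy; apply/holds_eval_var => //; exact: h.
Qed.

Lemma GL_T_skeleton a : GL (MImp (MBoxPlus (T (skeleton a))) (skeleton_subst a)).
Proof.
by apply: GL_boxplus_imp => x xx /(T_skeleton _ xx)/(mcs_and _ _ xx)[].
Qed.

Lemma GL_T_skeleton_inv a : GL (MImp (MBoxPlus (skeleton_subst a)) (T (skeleton a))).
Proof. by apply/GL_mcs => x xx; apply/mcs_imp => // /(T_skeleton _ xx). Qed.

End Shadow.

(** * The identity sigma (rho M) = M and the isomorphisms *)

Lemma sigma_rho_logics M : NExt modal_logic GL M -> sigma_logics (rho_logics M) = M.
Proof.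
move=> [MC GLM]; apply/seteqP; split.
  by apply: smallest_sub => // a [/GLM//|[b Mb <-]].
move=> a Ma; pose Phi := subformulas a.
have aP : {subset subformulas a <= Phi} by [].
(* As [M] contains the instance [skeleton_subst Phi a], the skeleton lies in [rho_logics M]; going
   back, [open_subst] yields the shadow instance of [a], from which [a] follows. *)
have Mskel : M (T (skeleton Phi a)).
  have [_ sub _ _] := MC.
  apply: (modal_logic_boxplus MC GLM (GL_T_skeleton_inv _ _)).
  exact/sub/sub.
have [SC GLS] : NExt modal_logic GL (sigma_logics (rho_logics M)).
  exact: oplus_NExt modal_logic_cap _.
apply: (modal_logic_boxplus SC GLS (GL_shadow_subst_inv aP)).
rewrite -skeleton_subst_inst; have [_ sub _ _] := SC; apply: sub.
apply: (modal_logic_boxplus SC GLS (GL_T_skeleton _ _)).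
by apply: sub_gen_smallest; right; exists (skeleton Phi a).
Qed.

Lemma sigma_rho_rules M : NExt modal_rule_system GL_R M ->
  sigma_rules (rho_rules M) = M.
Proof.
move=> [MC GLM]; apply/seteqP; split.
  by apply: smallest_sub => // a [/GLM//|[b Mb <-]].
move=> r Mr.
(* One [Phi] covers the whole rule, since a single substitution must act on all its premises and
   conclusions. *)
pose Phi := flatten [seq subformulas a | a <- enum_fset r.1 ++ enum_fset r.2].
have rP a : a \in r.1 \/ a \in r.2 -> {subset subformulas a <= Phi}.
  move=> ar b ba; apply/flattenP; exists (subformulas a) => //; apply: map_f.
  by rewrite mem_cat; apply/orP.
have Mskel : M (T_rule (map_rule (skeleton Phi) r)).
  have [SM _ _ _] := MC; have [sub _ _ _] := SM.
  rewrite /T_rule map_rule_comp.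
  have : M (map_rule (skeleton_subst Phi) r).
    have := sub (fun n => T (IVar n)) _ (sub (profile_subst Phi) _ Mr).
    by rewrite map_rule_comp.
  apply: (rule_transfer SM) => a _; apply: (modal_rule_boxplus MC GLM).
    exact: GL_T_skeleton.
  exact: GL_T_skeleton_inv.
have [SC GLS] : NExt modal_rule_system GL_R (sigma_rules (rho_rules M)).
  exact: oplus_NExt modal_rule_system_cap _.
have [SS _ _ _] := SC; have [sub _ _ _] := SS.
have : sigma_rules (rho_rules M) (map_rule (skeleton_subst Phi) r).
  have : sigma_rules (rho_rules M) (T_rule (map_rule (skeleton Phi) r)).
    by apply: sub_gen_smallest; right; exists (map_rule (skeleton Phi) r).
  rewrite /T_rule map_rule_comp.
  apply: (rule_transfer SS) => a _; apply: (modal_rule_boxplus SC GLS).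
    exact: GL_T_skeleton_inv.
  exact: GL_T_skeleton.
move=> /(sub open_subst); rewrite map_rule_comp => Sr.
have -> : r = map_rule id r.
  by case: (r) => G D; rewrite /map_rule /= !imfset_id.
(* A premise must yield its shadow instance; for conclusions the converse is required. *)
apply: (rule_transfer SS) Sr => a ar; apply: (modal_rule_boxplus SC GLS);
  rewrite /= skeleton_subst_inst.
  by apply: GL_shadow_subst; apply: rP; left.
by apply: GL_shadow_subst_inv; apply: rP; right.
Qed.

Theorem theorem5p35 :
  mutually_inverse_complete_lattice_isos
    msi_rule_system KM_R modal_rule_system GL_R sigma_rules rho_rules /\
  mutually_inverse_complete_lattice_isos
    msi_logic KM modal_logic GL sigma_logics rho_logics.
Proof.
split; apply: order_isos.
- exact: msi_rule_system_cap.
- exact: modal_rule_system_cap.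
- by move=> L _; exact: oplus_NExt modal_rule_system_cap _.
- exact: rho_rules_NExt.
- by move=> A B AB; apply: oplus_mono; exact: image_subset.
- by move=> A B AB r; exact: AB.
- by move=> L [LC KML]; exact: rho_sigma_rules.
- exact: sigma_rho_rules.
- exact: msi_logic_cap.
- exact: modal_logic_cap.
- by move=> L _; exact: oplus_NExt modal_logic_cap _.
- exact: rho_logics_NExt.
- by move=> A B AB; apply: oplus_mono; exact: image_subset.
- by move=> A B AB r; exact: AB.
- exact: rho_sigma_logics.
- exact: sigma_rho_logics.
Qed.
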